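(* Let $\lambda>0$ and $\lambda_1,\mu,\mu_1\in\mathbb{R}$, let $H$ be the operator on $\ell_2(\mathbb{Z})$ and $\alpha,\delta,\sigma,\kappa$ the quantities defined in the context, and let $s_d(H)$ be the discrete spectrum of $H$. Suppose $\alpha=\lambda_1/\lambda\neq-1$. Then: a) If $(\alpha,\delta,\sigma)\in U_1(+,+)$, then $s_d(H)=\{\nu_1,\nu_2,\nu_3\}$, where $\nu_3=\kappa$, $\nu_1,\nu_2\in(4\lambda,\infty)$ and, moreover, $$4\lambda<\nu_1<2\lambda\Bigl(\min\Bigl\{\sigma,\frac{\delta^2+1}{2\delta}\Bigr\}+1\Bigr)\le 2\lambda\Bigl(\max\Bigl\{\sigma,\frac{\delta^2+1}{2\delta}\Bigr\}+1\Bigr)<\nu_2 .$$ b) If $(\alpha,\delta,\sigma)\in U_0(+,+)$, then $s_d(H)=\emptyset$. c) If $(\alpha,\delta,\sigma)\in U_{-1}(+,+)$, then $s_d(H)=\{\nu_1,\nu_2,\nu_3\}$, where $\nu_3=\kappa$, $\nu_1,\nu_2\in(-\infty,0)$ and, moreover, $$\nu_1<2\lambda\Bigl(\min\Bigl\{\sigma,\frac{\delta^2+1}{2\delta}\Bigr\}+1\Bigr)\le 2\lambda\Bigl(\max\Bigl\{\sigma,\frac{\delta^2+1}{2\delta}\Bigr\}+1\Bigr)<\nu_2<0 .$$ d) If $(\alpha,\delta,\sigma)\in U(-,+)$, then: d1) for $|\delta|\le 1$, $s_d(H)=\{\nu_1\}$, where $\nu_1\in(4\lambda,\infty)$; d2)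 for $|\delta|>1$, $s_d(H)=\{\nu_1,\nu_2\}$, where $\nu_1\in(4\lambda,\infty)$ and $\nu_2=\kappa$. e) If $(\alpha,\delta,\sigma)\in U(-,-)$, then: e1) for $|\delta|\le1$, $s_d(H)=\{\nu_1,\nu_2\}$, where $\nu_1\in(-\infty,0)$ and $\nu_2\in(4\lambda,\infty)$; e2) for $|\delta|>1$, $s_d(H)=\{\nu_1,\nu_2,\nu_3\}$, where $\nu_1\in(-\infty,0)$, $\nu_2\in(4\lambda,\infty)$ and $\nu_3=\kappa$. f) If $(\alpha,\delta,\sigma)\in U(+,-)$, then: f1) for $|\delta|\le1$, $s_d(H)=\{\nu_1\}$, where $\nu_1\in(-\infty,0)$; f2) for $|\delta|>1$, $s_d(H)=\{\nu_1,\nu_2\}$, where $\nu_1\in(-\infty,0)$ and $\nu_2=\kappa$. g) All these eigenvalues have geometric multiplicity $1$. The eigenvector $f=\{f_n\}\in \ell_2(\mathbb{Z})$ corresponding to the eigenvalue $\kappa$ (when $\kappa$ occurs in the list above) is odd, i.e. $f_n=-f_{-n}$ for all $n$, and the eigenvectors corresponding to the other eigenvalues listed above are even, i.e. $f_n=f_{-n}$ for all $n$.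
   Context: $\ell_2(\mathbb{Z})$ is the complex Hilbert space of square-summable sequences $f=\{f_n\in\mathbb{C}\}_{n\in\mathbb{Z}}$ with standard basis $\{e_n\}_{n\in\mathbb{Z}}$. For real parameters $\lambda>0$, $\lambda_1,\mu,\mu_1$, the bounded self-adjoint operator $H=H_0+H_1$ on $\ell_2(\mathbb{Z})$ is given by $$H_0e_n=-\lambda(e_{n+1}-2e_n+e_{n-1})\quad (n\in\mathbb{Z}),$$ $$H_1e_0=-\lambda_1(e_1-2e_0+e_{-1})+\mu e_0,\quad H_1e_1=-\lambda_1e_0+\mu_1e_1,\quad H_1e_{-1}=-\lambda_1e_0+\mu_1e_{-1},$$ $$H_1e_n=0\quad\text{if }|n|>1.$$ The essential spectrum of $H$ is $[0,4\lambda]$. The discrete spectrum $s_d(H)$ is the set of isolated points of the spectrum that are eigenvalues of finite multiplicity (equivalently, the set of eigenvalues of $H$ lying outside $[0,4\lambda]$). Put $$\alpha=\frac{\lambda_1}{\lambda},\qquad \delta=\frac{\mu_1}{\lambda},\qquad \sigma=\frac{2\lambda_1+\mu}{2\lambda},$$ $$c_1=(\delta-1)(\sigma-1)-(\alpha+1)^2,\qquad c_2=(\delta+1)(\sigma+1)-(\alpha+1)^2,$$ $$\kappa=\frac{\lambda(\delta+1)^2}{\delta}=\frac{(\mu_1+\lambda)^2}{\mu_1}\quad\text{for }\mu_1\neq0.$$ The following subsets of $\mathbb{R}^3$ (triples $(\alpha,\delta,\sigma)$) are used: - $U_1(+,+)=\{c_1>0,\ c_2>0,\ \delta>1,\ \sigma>1\}$;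 - $U_0(+,+)=\{c_1\ge0,\ c_2\ge0,\ |\delta|\le1,\ |\sigma|\le1\}$; - $U_{-1}(+,+)=\{c_1>0,\ c_2>0,\ \delta<-1,\ \sigma<-1\}$; - $U(-,+)=\{c_1<0,\ c_2\ge0\}\cup\{c_1=0,\ c_2>0,\ \delta>1,\ \sigma>1\}$; - $U(-,-)=\{c_1<0,\ c_2<0\}$; - $U(+,-)=\{c_1\ge0,\ c_2<0\}\cup\{c_1>0,\ c_2=0,\ \delta<-1,\ \sigma<-1\}$. *)

(* Defs.v *)
From HB Require Import structures.
From mathcomp Require Import all_boot all_order all_algebra.
From mathcomp Require Import all_classical all_reals all_analysis.
From mathcomp Require Import complex.
From mathcomp Require Import ring lra.
Set Implicit Arguments.
Unset Strict Implicit.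
Unset Printing Implicit Defensive.
Import Order.TTheory GRing.Theory Num.Theory numFieldNormedType.Exports.
Import Normc.
Local Open Scope classical_set_scope.
Local Open Scope ring_scope.
Local Open Scope complex_scope.

Section Operators.
Variables (K : numFieldType) (V : normedModType K).
Implicit Types (T : {linear V -> V}) (z : K).

Definition resolvent_set T : set K :=
  [set z | exists B : {linear V -> V}, [/\ continuous B,
     forall f, B (T f - z *: f) = f & forall f, T (B f) - z *: B f = f]].

Definition spectrum T : set K := ~` resolvent_set T.

Definition eigenspace T z : set V := [set f | T f = z *: f].

Definition is_eigenvalue T z : Prop := exists2 f : V, f != 0 & eigenspace T z f.

(* [eigenspace T z] has a basis with [m] elements. *)
Definition geometric_multiplicity T z (m : nat) : Prop :=
  exists v : 'I_m -> V, (forall i, eigenspace T z (v i)) /\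
    forall f, eigenspace T z f ->
      exists! c : {ffun 'I_m -> K}, f = \sum_i c i *: v i.

Definition discrete_spectrum T : set K :=
  [set z | [/\ isolated (spectrum T) z, is_eigenvalue T z &
               exists m, geometric_multiplicity T z m]].

End Operators.

Section SquareSummable.
Variable R : realType.
Implicit Types f g : int -> R[i].

Definition sqnorm f : \bar R := \esum_(n in [set: int]) (normc (f n) ^+ 2)%:E.

Definition square_summable : {pred int -> R[i]} := fun f => (sqnorm f < +oo)%E.

Lemma sqnorm_ge0 f : (0 <= sqnorm f)%E.
Proof. by apply: esum_ge0 => n _; rewrite lee_fin sqr_ge0. Qed.

Lemma normc_ge0 (x : R[i]) : 0 <= normc x.
Proof. by case: x => a b; rewrite sqrtr_ge0. Qed.

Lemma normcD_sqr_le (t : R) (x y : R[i]) : 0 < t ->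
  normc (x + y) ^+ 2 <= (1 + t) * normc x ^+ 2 + (1 + t^-1) * normc y ^+ 2.
Proof.
move=> t0.
have h : normc (x + y) ^+ 2 <= (normc x + normc y) ^+ 2.
  by rewrite lerXn2r ?nnegrE ?addr_ge0 ?normc_ge0 ?le_normcD.
apply: le_trans h _.
have st0 : Num.sqrt t != 0 by rewrite gt_eqF ?sqrtr_gt0.
have tE : t = Num.sqrt t ^+ 2 by rewrite sqr_sqrtr// ltW.
rewrite -subr_ge0.
rewrite (_ : _ - _ = (Num.sqrt t * normc x - (Num.sqrt t)^-1 * normc y) ^+ 2) ?sqr_ge0//.
move: (Num.sqrt t) st0 tE => s s0 ->.
by field.
Qed.

Lemma esumZl (a : R) (u : int -> R) : 0 < a ->
  \esum_(n in [set: int]) (a * u n)%:E =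
  (a%:E * \esum_(n in [set: int]) (u n)%:E)%E.
Proof.
move=> a0; rewrite /esum -ereal_sup_pZl// image_comp/=.
congr ereal_sup; apply: eq_imagel => A [finA _] /=.
by rewrite !fsbig_finite//= !sumEFin -EFinM mulr_sumr.
Qed.

Lemma sqnorm0 : sqnorm 0 = 0%E.
Proof. by apply: esum1 => n _; rewrite [X in normc X](_ : _ = 0)// normc0 expr0n. Qed.

Lemma sqnormZ (a : R[i]) f : sqnorm (a *: f) = ((normc a ^+ 2)%:E * sqnorm f)%E.
Proof.
have [->|a0] := eqVneq a 0; first by rewrite scale0r sqnorm0 normc0 expr0n mul0e.
rewrite /sqnorm -esumZl; last first.
  rewrite exprn_gt0// lt_def normc_ge0 andbT.
  by apply: contra a0 => /eqP/eq0_normc ->.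
by apply: eq_esum => n _; rewrite -exprMn -normcM.
Qed.

Lemma sqnormD_le (t : R) f g : 0 < t ->
  (sqnorm (f + g)%R <= (1 + t)%:E * sqnorm f + (1 + t^-1)%:E * sqnorm g)%E.
Proof.
move=> t0; have t'0 : 0 < t^-1 by rewrite invr_gt0.
have h1 : 0 < 1 + t by rewrite addr_gt0.
have h2 : 0 < 1 + t^-1 by rewrite addr_gt0.
rewrite /sqnorm -!esumZl// -esumD; last 2 first.
- by move=> n _; rewrite lee_fin mulr_ge0 ?sqr_ge0// ltW.
- by move=> n _; rewrite lee_fin mulr_ge0 ?sqr_ge0// ltW.
by apply: le_esum => n _; rewrite -EFinD lee_fin normcD_sqr_le.
Qed.

Lemma square_summable_submod : submod_closed square_summable.
Proof.
split=> [|a f g]; first by rewrite unfold_in sqnorm0 ltry.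
rewrite !unfold_in => hf hg; apply: le_lt_trans (sqnormD_le _ _ ltr01) _.
by rewrite lte_add_pinfty// lte_mul_pinfty ?sqnormZ ?lee_fin ?sqnorm_ge0//
  ?lte_mul_pinfty ?mule_ge0 ?lee_fin ?sqr_ge0 ?sqnorm_ge0 ?addr_ge0 ?invr_ge0.
Qed.

HB.instance Definition _ := GRing.isSubmodClosed.Build R[i] (int -> R[i])
  square_summable square_summable_submod.

Record l2 := L2 { l2val :> int -> R[i]; _ : l2val \in square_summable }.

HB.instance Definition _ := [isSub for l2val].
HB.instance Definition _ := [Choice of l2 by <:].
HB.instance Definition _ := [SubChoice_isSubLmodule of l2 by <:].

Implicit Types u v : l2.

Lemma l2P u : square_summable u. Proof. by case: u. Qed.

Lemma l2_eqP u v : (forall n, u n = v n) -> u = v.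
Proof. by move=> uv; apply: val_inj; apply/funext. Qed.

Lemma sqnorm_fin u : sqnorm u \is a fin_num.
Proof. by rewrite ge0_fin_numE ?sqnorm_ge0//; exact: l2P. Qed.

Definition l2norm_re u : R := Num.sqrt (fine (sqnorm u)).

Definition l2norm u : R[i] := (l2norm_re u)%:C.

Lemma l2norm_re_ge0 u : 0 <= l2norm_re u. Proof. exact: sqrtr_ge0. Qed.

Lemma sqnormE u : sqnorm u = (l2norm_re u ^+ 2)%:E.
Proof. by rewrite sqr_sqrtr ?fine_ge0 ?sqnorm_ge0// fineK// sqnorm_fin. Qed.

Lemma l2norm_re0_eq0 u : l2norm_re u = 0 -> u = 0.
Proof.
move=> u0; apply: l2_eqP => n.
have : (sqnorm u <= 0)%E by rewrite sqnormE u0 expr0n.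
rewrite /sqnorm (esumID [set n])//; last by move=> *; rewrite lee_fin sqr_ge0.
rewrite setTI esum_set1 ?lee_fin ?sqr_ge0// => h.
have {}h : ((normc (u n) ^+ 2)%:E <= 0)%E.
  apply: le_trans h; rewrite leeDl//.
  by apply: esum_ge0 => *; rewrite lee_fin sqr_ge0.
move: h; rewrite lee_fin => h.
by apply: eq0_normc; apply/eqP; rewrite -sqrf_eq0 eq_le h sqr_ge0.
Qed.

Lemma l2norm_reD u v : l2norm_re (u + v) <= l2norm_re u + l2norm_re v.
Proof.
have [/l2norm_re0_eq0 ->|u0] := eqVneq (l2norm_re u) 0.
  by rewrite add0r lerDr l2norm_re_ge0.
have [/l2norm_re0_eq0 ->|v0] := eqVneq (l2norm_re v) 0.
  by rewrite addr0 lerDl l2norm_re_ge0.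
have up : 0 < l2norm_re u by rewrite lt_def u0 l2norm_re_ge0.
have vp : 0 < l2norm_re v by rewrite lt_def v0 l2norm_re_ge0.
have := @sqnormD_le (l2norm_re v / l2norm_re u) u v (divr_gt0 vp up).
rewrite (_ : (u : int -> R[i]) + v = (u + v : l2))//.
rewrite !sqnormE -!EFinM -EFinD lee_fin => h.
rewrite -(@ler_pXn2r _ 2)// ?nnegrE ?addr_ge0 ?l2norm_re_ge0//.
apply: le_trans h _; rewrite le_eqVlt; apply/orP; left; apply/eqP.
by field; rewrite u0 v0.
Qed.

Lemma l2normD u v : l2norm (u + v) <= l2norm u + l2norm v.
Proof. by rewrite /l2norm -rmorphD lecR l2norm_reD. Qed.

Lemma l2normZ (a : R[i]) u : l2norm (a *: u) = `|a| * l2norm u.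
Proof.
rewrite /l2norm (_ : `|a| = (normc a)%:C)// -rmorphM; congr (_%:C).
rewrite /l2norm_re (_ : l2val (a *: u) = a *: l2val u)// sqnormZ sqnormE.
by rewrite -EFinM/= -exprMn !sqrtr_sqr !ger0_norm ?mulr_ge0 ?normc_ge0
  ?l2norm_re_ge0.
Qed.

Lemma l2norm0_eq0 u : l2norm u = 0 -> u = 0.
Proof. by move=> /complexI; exact: l2norm_re0_eq0. Qed.

Lemma l2DE u v n : (u + v) n = u n + v n. Proof. by []. Qed.

Lemma l2NE u n : (- u) n = - u n. Proof. by []. Qed.

Lemma l2ZE (a : R[i]) u n : (a *: u) n = a * u n. Proof. by []. Qed.

Definition l2E := (l2DE, l2NE, l2ZE).

HB.instance Definition _ :=
  Lmodule_isNormed.Build R[i] l2 l2normD l2normZ l2norm0_eq0.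

Lemma square_summable_basis (n : int) :
  (fun m => (m == n)%:R : R[i]) \in square_summable.
Proof.
rewrite unfold_in /sqnorm (esumID [set n]); last first.
  by move=> *; rewrite lee_fin sqr_ge0.
rewrite setTI esum_set1 ?lee_fin ?sqr_ge0// setTI esum1 ?adde0 ?ltry//.
by move=> m /= /eqP/negPf ->; rewrite normc0 expr0n.
Qed.

Definition e_ (n : int) : l2 := L2 (square_summable_basis n).

Lemma square_summable_shift (k : int) u :
  (fun n => u (n - k)) \in square_summable.
Proof.
rewrite unfold_in; have := l2P u; rewrite /square_summable /sqnorm.
rewrite (@reindex_esum _ _ _ [set: int] [set: int] (fun n => n - k))//.
split=> //; first by move=> x y _ _ /addIr.
by move=> y _; exists (y + k) => //; rewrite addrK.
Qed.

(* [shift k] maps [e_ n] to [e_ (n + k)]. *)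
Definition shift (k : int) u : l2 := L2 (square_summable_shift k u).

Lemma shift_is_linear k : linear (shift k).
Proof. by move=> a u v; apply: l2_eqP. Qed.

HB.instance Definition _ (k : int) :=
  GRing.isLinear.Build R[i] l2 l2 *:%R (shift k) (shift_is_linear k).

Lemma shiftE k u n : shift k u n = u (n - k). Proof. by []. Qed.

Lemma shift_e (k n : int) : shift k (e_ n) = e_ (n + k).
Proof. by apply: l2_eqP => m /=; rewrite subr_eq. Qed.

Lemma norm_shift k u : `|shift k u| = `|u|.
Proof.
rewrite /Num.norm/= /l2norm /l2norm_re /sqnorm; congr (Num.sqrt (fine _))%:C.
rewrite [RHS](@reindex_esum _ _ _ [set: int] [set: int] (fun n => n - k))//.
split=> //; first by move=> x y _ _ /addIr.
by move=> y _; exists (y + k) => //; rewrite addrK.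
Qed.

Lemma shift_continuous k : continuous (shift k).
Proof.
apply: bounded_linear_continuous; apply/linear_boundedP; near=> r => u.
rewrite norm_shift ler_peMl//; near: r.
Unshelve. all: by end_near. Qed.

Lemma normr_coord_le u n : `|u n| <= `|u|.
Proof.
rewrite [leRHS](_ : _ = (l2norm_re u)%:C)// [leLHS](_ : _ = (normc (u n))%:C)//.
rewrite lecR -(@ler_pXn2r _ 2)// ?nnegrE ?normc_ge0 ?l2norm_re_ge0//.
rewrite -lee_fin -sqnormE /sqnorm (esumID [set n])//; last first.
  by move=> *; rewrite lee_fin sqr_ge0.
rewrite setTI esum_set1 ?lee_fin ?sqr_ge0// leeDl//.
by apply: esum_ge0 => *; rewrite lee_fin sqr_ge0.
Qed.

Lemma coord_continuous n : continuous (fun u : l2 => u n : R[i]^o).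
Proof.
move=> u; apply/(@cvgrPdist_lt _ _ _ (nbhs u)) => e e0; near=> v.
rewrite (_ : u n - v n = (u - v) n)//; apply: le_lt_trans (normr_coord_le _ _) _.
by near: v; apply: cvgr_dist_lt.
Unshelve. all: by end_near. Qed.

End SquareSummable.

Arguments e_ {R} n.

Section Hamiltonian.
Variables (R : realType) (lam lam1 mu mu1 : R).
Implicit Types f g : l2 R.

Definition opH0 f : l2 R := - lam%:C *: (shift 1 f - 2 *: f + shift (-1) f).

(* The linear extension of the prescribed values on [e_ 0], [e_ 1], [e_ (-1)],
   vanishing on the other basis vectors. *)
Definition opH1 f : l2 R :=
  f 0 *: (- lam1%:C *: (e_ 1 - 2 *: e_ 0 + e_ (-1)) + mu%:C *: e_ 0)
  + f 1 *: (- lam1%:C *: e_ 0 + mu1%:C *: e_ 1)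
  + f (-1) *: (- lam1%:C *: e_ 0 + mu1%:C *: e_ (-1)).

Definition opH f : l2 R := opH0 f + opH1 f.

Lemma opH_is_linear : linear opH.
Proof.
move=> a f g; apply: l2_eqP => n.
rewrite /opH /opH0 /opH1.
rewrite !(l2E, shiftE).
ring.
Qed.

HB.instance Definition _ :=
  GRing.isLinear.Build R[i] (l2 R) (l2 R) *:%R opH opH_is_linear.

Lemma opH0_e n :
  opH0 (e_ n) = - lam%:C *: (e_ (n + 1) - 2 *: e_ n + e_ (n - 1)).
Proof. by rewrite /opH0 !shift_e. Qed.

Lemma opH1_e0 :
  opH1 (e_ 0) = - lam1%:C *: (e_ 1 - 2 *: e_ 0 + e_ (-1)) + mu%:C *: e_ 0.
Proof. by rewrite /opH1 /= !scale0r !addr0 scale1r. Qed.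

Lemma opH1_e1 : opH1 (e_ 1) = - lam1%:C *: e_ 0 + mu1%:C *: e_ 1.
Proof. by rewrite /opH1 /= !scale0r addr0 add0r scale1r. Qed.

Lemma opH1_eN1 : opH1 (e_ (-1)) = - lam1%:C *: e_ 0 + mu1%:C *: e_ (-1).
Proof. by rewrite /opH1 /= !scale0r !add0r scale1r. Qed.

Lemma opH1_e n : 1 < `|n| -> opH1 (e_ n) = 0.
Proof.
move=> n1; rewrite /opH1 /=.
have -> : (0 == n) = false by apply/eqP => n0; move: n1; rewrite -n0.
have -> : (1 == n) = false by apply/eqP => n0; move: n1; rewrite -n0.
have -> : (-1 == n) = false by apply/eqP => n0; move: n1; rewrite -n0.
by rewrite !scale0r !addr0.
Qed.

Lemma opH_continuous : continuous opH.
Proof.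
move=> f; have cS k : {for f, continuous (shift k)} by exact: shift_continuous.
have cC n : {for f, continuous (fun g : l2 R => g n : R[i]^o)} by exact: coord_continuous.
have cI : {for f, continuous (@id (l2 R))} by exact: cvg_id.
apply: (continuousD (f := opH0) (g := opH1)).
  exact: (continuousZl_tmp (continuousD
    (continuousB (cS 1) (continuousZl_tmp (k := 2) cI)) (cS (-1)))).
exact: (continuousD (continuousD (continuousZr_tmp (cC 0))
  (continuousZr_tmp (cC 1))) (continuousZr_tmp (cC (-1)))).
Qed.

End Hamiltonian.

Section Regions.
Variable R : realType.

Definition alpha (lam lam1 : R) := lam1 / lam.
Definition delta (lam mu1 : R) := mu1 / lam.
Definition sigma (lam lam1 mu : R) := (2 * lam1 + mu) / (2 * lam).

Definition c1 (a d s : R) := (d - 1) * (s - 1) - (a + 1) ^+ 2.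
Definition c2 (a d s : R) := (d + 1) * (s + 1) - (a + 1) ^+ 2.

(* Since [0^-1 = 0], this is 0 when [mu1 = 0], where it has no meaning. *)
Definition kappa (lam mu1 : R) := lam * (delta lam mu1 + 1) ^+ 2 / delta lam mu1.

(* In the names below, [p] stands for + and [n] for -; elements are triples
   [(alpha, delta, sigma)]. *)
Definition U1_pp : set (R * R * R) := [set p | let: (a, d, s) := p in
  [/\ 0 < c1 a d s, 0 < c2 a d s, 1 < d & 1 < s]].

Definition U0_pp : set (R * R * R) := [set p | let: (a, d, s) := p in
  [/\ 0 <= c1 a d s, 0 <= c2 a d s, `|d| <= 1 & `|s| <= 1]].

Definition UN1_pp : set (R * R * R) := [set p | let: (a, d, s) := p in
  [/\ 0 < c1 a d s, 0 < c2 a d s, d < -1 & s < -1]].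

Definition U_np : set (R * R * R) :=
  [set p | let: (a, d, s) := p in c1 a d s < 0 /\ 0 <= c2 a d s] `|`
  [set p | let: (a, d, s) := p in
    [/\ c1 a d s = 0, 0 < c2 a d s, 1 < d & 1 < s]].

Definition U_nn : set (R * R * R) :=
  [set p | let: (a, d, s) := p in c1 a d s < 0 /\ c2 a d s < 0].

Definition U_pn : set (R * R * R) :=
  [set p | let: (a, d, s) := p in 0 <= c1 a d s /\ c2 a d s < 0] `|`
  [set p | let: (a, d, s) := p in
    [/\ 0 < c1 a d s, c2 a d s = 0, d < -1 & s < -1]].

End Regions.

Section Parity.
Variable R : realType.
Implicit Types (T : {linear l2 R -> l2 R}) (z : R[i]).

Definition simple_even T z : Prop :=
  geometric_multiplicity T z 1 /\
  forall f, eigenspace T z f -> forall n, f n = f (- n).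

Definition simple_odd T z : Prop :=
  geometric_multiplicity T z 1 /\
  forall f, eigenspace T z f -> forall n, f n = - f (- n).

End Parity.

(* Main.v *)
(* Write an energy as zeta x = lam (2 - x - 1/x) with 0 < |x| <= 1.  An l2
   solution of H f = zeta x f is geometric of ratio x on both half-lines, so the
   eigenvalue problem reduces to the equations at the sites -1, 0, 1.  If |x| = 1,
   i.e. zeta x in [0, 4 lam], the geometric tails vanish and so does f.  If
   |x| < 1, then H - zeta x is a rank-three perturbation of H0 - zeta x, which is
   a multiple of (1 - x S)(1 - x S^-1) with S the shift and is inverted by
   geometric series; hence zeta x is either in the resolvent set or an eigenvalue.
   With y = 1/x the eigenvalues correspond to y = - delta (odd eigenvectors) and
   to the solutions of
     (delta + y) (2 sigma + y + 1/y) = 2 (alpha + 1)^2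
   (even eigenvectors), which are real by comparison of imaginary parts.  For
   y > 1 both factors increase and they have a common sign, so there is at most
   one solution with positive factors and one with negative factors, and the
   signs of c2 and of delta + 1 decide which exist; y < -1 reduces to y > 1 by
   changing the signs of y, delta and sigma. *)
From HB Require Import structures.
From Pilot Require Import Defs.
From mathcomp Require Import all_boot all_order all_algebra.
From mathcomp Require Import all_classical all_reals all_analysis.
From mathcomp Require Import complex.
From mathcomp Require polyrcf.
From mathcomp Require Import ring lra zify.
Set Implicit Arguments.
Unset Strict Implicit.
Unset Printing Implicit Defensive.
Import Order.TTheory GRing.Theory Num.Theory numFieldNormedType.Exports.
Import Normc.
Local Open Scope classical_set_scope.
Local Open Scope ring_scope.
Local Open Scope complex_scope.

(** * Solutions of the even secular equation *)

Section Branches.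
Variables (R : rcfType) (d s b : R).
Implicit Types y z : R.

Lemma ltr_addV y z : 1 <= y -> y < z -> y + y^-1 < z + z^-1.
Proof.
move=> y1 yz; have y0 : 0 < y by lra.
have z0 : 0 < z by lra.
rewrite -subr_gt0.
have -> : z + z^-1 - (y + y^-1) = (z - y) * (y * z - 1) / (y * z).
  by field; rewrite !gt_eqF.
rewrite divr_gt0 ?mulr_gt0 ?subr_gt0//.
by rewrite (le_lt_trans y1)// ltr_pMr// (le_lt_trans y1).
Qed.

(** [b] stands for (alpha + 1)^2 and the last clause is the even secular equation. When b > 0 the
    two factors of a root have a common sign, and this sign names the branch. *)
Definition pos_branch y := [/\ 1 < y, 0 < d + y, 0 < 2 * s + (y + y^-1) &
  (d + y) * (2 * s + (y + y^-1)) = 2 * b].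

Definition neg_branch y := [/\ 1 < y, d + y < 0, 2 * s + (y + y^-1) < 0 &
  (d + y) * (2 * s + (y + y^-1)) = 2 * b].

(** Both factors are positive and strictly increasing along this branch, so their product takes the
    value 2 b at most once. *)
Lemma pos_branch_inj y z : pos_branch y -> pos_branch z -> y = z.
Proof.
have wlg u v : pos_branch u -> pos_branch v -> ~~ (u < v).
  move=> [u1 du su eu] [v1 dv sv ev]; apply/negP => uv.
  have h := ltr_addV (ltW u1) uv.
  have : (d + u) * (2 * s + (u + u^-1)) < (d + v) * (2 * s + (v + v^-1)).
    by apply: ltr_pM; lra.
  by rewrite eu ev ltxx.
move=> hy hz; case: (ltgtP y z) => // h.
  by have := wlg _ _ hy hz; rewrite h.
by have := wlg _ _ hz hy; rewrite h.
Qed.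

(** The opposites of both factors are positive and strictly decreasing here, hence so is the
    product. *)
Lemma neg_branch_inj y z : neg_branch y -> neg_branch z -> y = z.
Proof.
have wlg u v : neg_branch u -> neg_branch v -> ~~ (u < v).
  move=> [u1 du su eu] [v1 dv sv ev]; apply/negP => uv.
  have h := ltr_addV (ltW u1) uv.
  have : (- (d + v)) * (- (2 * s + (v + v^-1)))
         < (- (d + u)) * (- (2 * s + (u + u^-1))).
    by apply: ltr_pM; lra.
  by rewrite !mulrNN eu ev ltxx.
move=> hy hz; case: (ltgtP y z) => // h.
  by have := wlg _ _ hy hz; rewrite h.
by have := wlg _ _ hz hy; rewrite h.
Qed.

Hypothesis b0 : 0 < b.

Lemma branchP y : 1 < y -> (d + y) * (2 * s + (y + y^-1)) = 2 * b ->
  pos_branch y \/ neg_branch y.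
Proof.
move=> y1 e.
have : 0 < (d + y) * (2 * s + (y + y^-1)) by rewrite e mulr_gt0.
case: (ltgtP (d + y) 0) => [h|h|->]; last by rewrite mul0r ltxx.
- by rewrite nmulr_rgt0// => h'; right.
- by rewrite pmulr_rgt0// => h'; left.
Qed.

(** For d >= -1 both factors have grown since y = 1, where they equal d + 1 and 2 (s + 1). If s + 1
    < 0 the product of these two is nonpositive and so below 2 b anyway. *)
Lemma pos_branch_lt y : pos_branch y -> (d + 1) * (s + 1) < b \/ d < -1.
Proof.
move=> [y1 dy sy e].
have [|d1] := ltP d (-1); [by right|left].
have h := ltr_addV (lexx 1) y1; rewrite invr1 in h.
have [s1|s1] := ltP (s + 1) 0.
  by apply: le_lt_trans b0; rewrite mulr_ge0_le0//; lra.
have : (d + 1) * (2 * (s + 1)) < (d + y) * (2 * s + (y + y^-1)).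
  by apply: ltr_pM; lra.
by rewrite e; nra.
Qed.

(** Both factors are still more negative at y = 1, so their product is larger there. *)
Lemma neg_branch_gt y : neg_branch y ->
  [/\ b < (d + 1) * (s + 1), d < -1 & s < -1].
Proof.
move=> [y1 dy sy e].
have h := ltr_addV (lexx 1) y1; rewrite invr1 in h.
have : (- (d + y)) * (- (2 * s + (y + y^-1))) < (- (d + 1)) * (- (2 * (s + 1))).
  by apply: ltr_pM; lra.
rewrite !mulrNN e => ?; split; nra.
Qed.

Lemma branch_ivt (t u : R) : 1 <= t -> t <= u ->
  ((d + t) * (2 * s + (t + t^-1)) - 2 * b) *
  ((d + u) * (2 * s + (u + u^-1)) - 2 * b) < 0 ->
  exists y, [/\ t < y, y < u & (d + y) * (2 * s + (y + y^-1)) = 2 * b].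
Proof.
move=> t1 tu.
(* Multiplying the equation by y > 0 clears the inverse and keeps signs, so the intermediate value
   theorem for polynomials applies. *)
pose P : {poly R} := ('X + d%:P) * ('X^2 + (2 * s)%:P * 'X + 1%:P) - (2 * b)%:P * 'X.
have PE y : 0 < y -> P.[y] = y * ((d + y) * (2 * s + (y + y^-1)) - 2 * b).
  by move=> y0; rewrite /P !hornerE /=; field; rewrite gt_eqF.
set ft := _ - _; set fu := _ - _ => ftu.
have t0 : 0 < t by lra.
have u0 : 0 < u by lra.
have PtPu : P.[t] * P.[u] < 0.
  by rewrite !PE// -/ft -/fu mulrACA pmulr_rlt0// mulr_gt0.
have [y /itvP yI /rootP] := polyrcf.poly_ivtoo tu PtPu.
have y0 : 0 < y by rewrite (lt_trans t0)// yI.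
rewrite PE// => /eqP; rewrite mulf_eq0 gt_eqF//= subr_eq0 => /eqP e.
by exists y; rewrite !yI.
Qed.

(** The larger root of y^2 - 2 c y + 1 works: the two roots are inverse to each other and have sum 2
    c. *)
Lemma addV_surj (c : R) : 1 < c -> exists2 y, 1 < y & y + y^-1 = 2 * c.
Proof.
move=> c1; exists (c + Num.sqrt (c ^+ 2 - 1)).
  by rewrite (lt_le_trans c1)// lerDl sqrtr_ge0.
have h : 0 <= c ^+ 2 - 1 by nra.
have := sqr_sqrtr h; have := sqrtr_ge0 (c ^+ 2 - 1).
move: (Num.sqrt _) => q q0 qE.
have cq : c + q != 0 by rewrite gt_eqF//; lra.
have -> : (c + q)^-1 = c - q; last by ring.
apply: (mulfI cq); rewrite mulfV//.
by rewrite mulrC -subr_sqr qE; ring.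
Qed.

(** Let [t] be the least point of [1, oo) where both factors are nonnegative. The product is below 2
    b at [t], since a factor vanishes there or t = 1 and the hypothesis on (d + 1) (s + 1) applies;
    it exceeds 2 b far to the right. *)
Lemma pos_branch_exists : (d + 1) * (s + 1) < b \/ d < -1 ->
  exists y, pos_branch y.
Proof.
move=> hyp.
have [t [t1 dt st ft]] : exists t, [/\ 1 <= t, 0 <= d + t,
    0 <= 2 * s + (t + t^-1) & (d + t) * (2 * s + (t + t^-1)) < 2 * b].
  have [r r1 rE] : exists2 r, 1 <= r & 0 <= 2 * s + (r + r^-1) /\
      (s < -1 -> 2 * s + (r + r^-1) = 0) /\ (-1 <= s -> r = 1).
    have [s1|s1] := ltP s (-1).
      have [r r1 rE] := @addV_surj (- s) ltac:(lra).
      by exists r; rewrite ?(ltW r1)// rE; split=> [|]; first lra; split; lra.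
    by exists 1 => //; rewrite invr1; split; first lra; split; lra.
  case: rE => rE [rE0 rE1].
  have [dr|dr] := leP (- d) r.
    exists r; split=> //; first lra.
    have [s1|s1] := ltP s (-1); first by rewrite rE0// mulr0 mulr_gt0.
    rewrite (rE1 s1) invr1 in dr *; have -> : 2 * s + (1 + 1) = 2 * (s + 1) by ring.
    by rewrite mulrCA ltr_pM2l//; case: hyp => //; lra.
  exists (- d); split; [lra|lra| |].
    have := @ltr_addV r (- d) r1 dr; lra.
  by rewrite subrr mul0r mulr_gt0.
(* The increment 2 (b + 1) makes the first factor at least 2 b + 2. As 1/u <= 1/2, the second one
   grows by at least half the increment, so the product is at least 2 (b + 1)^2 > 2 b. *)
pose u := t + 2 * b + 2.
have uV : u^-1 <= 1 / 2.
  have u2 : 2 <= u by have := b0; rewrite /u; lra.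
  by rewrite div1r lef_pV2 ?posrE//; lra.
have tu : t <= u by have := b0; rewrite /u; lra.
have hu : b + 1 <= 2 * s + (u + u^-1).
  have : (b + 1) <= (u + u^-1) - (t + t^-1).
    have t0 : 0 < t by lra.
    have u0 : 0 < u by lra.
    have -> : u + u^-1 - (t + t^-1) = (u - t) * (1 - u^-1 * t^-1).
      by field; rewrite !gt_eqF.
    have : u^-1 * t^-1 <= 1 / 2 * 1.
      by rewrite ler_pM ?invr_ge0 ?(ltW t0) ?(ltW u0) ?invf_le1.
    have -> : u - t = 2 * (b + 1) by rewrite /u; ring.
    by have := b0; nra.
  lra.
have du : 2 * b + 2 <= d + u by rewrite /u; lra.
have fu : 2 * b < (d + u) * (2 * s + (u + u^-1)).
  have : (2 * b + 2) * (b + 1) <= (d + u) * (2 * s + (u + u^-1)).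
    by apply: ler_pM; have := b0; lra.
  by have := b0; nra.
have [|y [ty _ yE]] := branch_ivt t1 tu.
  by rewrite pmulr_llt0 ?subr_gt0// subr_lt0.
have := ltr_addV t1 ty; exists y; split; lra.
Qed.

(** At 1 both factors are negative with product above 2 b. At [u], the first point where one of them
    vanishes, the product is 0, so it crosses 2 b while both are still negative. *)
Lemma neg_branch_exists : b < (d + 1) * (s + 1) -> d < -1 ->
  exists y, neg_branch y.
Proof.
move=> c2 d1; have s1 : s < -1 by have := b0; nra.
have [r r1 rE] := @addV_surj (- s) ltac:(lra).
have [u [u1 ur ud u0]] : exists u, [/\ 1 < u, u <= r, u <= - d &
    (d + u) * (2 * s + (u + u^-1)) = 0].
  have [h|h] := leP r (- d).
    by exists r; split=> //; rewrite rE; ring.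
  by exists (- d); split=> //; [lra|lra|rewrite subrr mul0r].
have [|y [y1 yu yE]] := branch_ivt (lexx 1) (ltW u1).
  rewrite u0 invr1; have := b0; nra.
have yr : y < r by lra.
have := ltr_addV (ltW y1) yr; exists y; split; lra.
Qed.

Definition branch y := pos_branch y \/ neg_branch y.

Lemma no_branch y : b <= (d + 1) * (s + 1) -> -1 <= d -> ~ branch y.
Proof.
move=> c2 d1 [/pos_branch_lt[]|/neg_branch_gt[_ ? _]]; lra.
Qed.

(** In the boundary case (d + 1) (s + 1) = b with d < -1, the root with negative factors sits at y =
    1 and is excluded; only the positive branch is left. *)
Lemma one_branch : (d + 1) * (s + 1) <= b -> (d + 1) * (s + 1) < b \/ d < -1 ->
  exists t, pos_branch t /\ forall y, branch y <-> y = t.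
Proof.
move=> c2 /pos_branch_exists[t pt]; exists t; split=> // y.
split=> [[py|/neg_branch_gt[? _ _]]|->]; [exact: pos_branch_inj|lra|by left].
Qed.

Lemma two_branches : b < (d + 1) * (s + 1) -> d < -1 ->
  exists t u, [/\ neg_branch t, pos_branch u &
    forall y, branch y <-> y = t \/ y = u].
Proof.
move=> c2 d1; have [t nt] := neg_branch_exists c2 d1.
have [u pu] := pos_branch_exists (or_intror d1).
exists t, u; split=> // y; split=> [[py|ny]|[]->].
- by right; exact: pos_branch_inj.
- by left; exact: neg_branch_inj.
- by right.
- by left.
Qed.

End Branches.

(** * Square-summable sequences *)

Section NormedOperators.
Variables (K : numFieldType) (V : normedModType K).

(** [T] is injective and maps the defect of linearity of [B] to 0. *)
Lemma right_inverse_linear (T : {linear V -> V}) (B : V -> V) :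
  (forall f, T f = 0 -> f = 0) -> cancel B T -> linear B.
Proof.
move=> T0 TB a f g; apply/eqP; rewrite -subr_eq0; apply/eqP; apply: T0.
by rewrite linearB linearP !TB subrr.
Qed.

(** Once T - z is injective, linearity of a right inverse and the left inverse property come for
    free, so only continuity and one identity need checking. *)
Lemma resolvent_setW (T : {linear V -> V}) z (B : V -> V) :
  (forall f, T f = z *: f -> f = 0) -> continuous B ->
  (forall f, T (B f) - z *: B f = f) -> resolvent_set T z.
Proof.
move=> T0 cB TB.
have Tz_lin : linear (fun f => T f - z *: f).
  move=> a f g; rewrite linearP scalerBr scalerDr !scalerA opprD addrACA.
  by rewrite [z * a]mulrC.
pose Tz : {linear V -> V} := HB.pack (fun f => T f - z *: f)
  (GRing.isLinear.Build K V V *:%R _ Tz_lin).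
have Tz0 f : Tz f = 0 -> f = 0.
  by move=> /(congr1 (fun g => g + z *: f)); rewrite subrK add0r => /T0.
pose B' : {linear V -> V} := HB.pack B
  (GRing.isLinear.Build K V V *:%R B (right_inverse_linear Tz0 TB)).
exists B'; split=> // f; apply/eqP; rewrite -subr_eq0; apply/eqP; apply: (Tz0).
by rewrite linearB [Tz (B' _)]TB subrr.
Qed.

End NormedOperators.

Section Sequences.
Variable R : realType.
Implicit Types (u f : l2 R) (x : R[i]).

Lemma normc_sqr (z : R[i]) : normc z ^+ 2 = complex.Re z ^+ 2 + complex.Im z ^+ 2.
Proof. by case: z => a b; rewrite /= sqr_sqrtr// addr_ge0 ?sqr_ge0. Qed.

Lemma l2norm_reE u : `|u| = (l2norm_re u)%:C. Proof. by []. Qed.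

Lemma l2norm_reZ x u : l2norm_re (x *: u) = normc x * l2norm_re u.
Proof. by apply: complexI; rewrite rmorphM/= -!l2norm_reE normrZ. Qed.

Lemma l2norm_re_shift k u : l2norm_re (Defs.shift k u) = l2norm_re u.
Proof. by apply: complexI; rewrite -!l2norm_reE norm_shift. Qed.

Lemma normc_coord_le u n : normc (u n) <= l2norm_re u.
Proof. by rewrite -lecR; exact: normr_coord_le. Qed.

(** Otherwise N |u (h 0)|^2 would bound the squared norm from below for every N. All uniqueness
    statements about decaying sequences rest on this. *)
Lemma l2_nondecr_eq0 u (h : nat -> int) : injective h ->
  (forall k, normc (u (h k)) <= normc (u (h k.+1))) -> u (h 0%N) = 0.
Proof.
move=> inj_h hle; apply: eq0_normc; apply: contrapT => /eqP c0.
have {}c0 : 0 < normc (u (h 0%N)) ^+ 2 by rewrite exprn_even_gt0.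
have hge k : normc (u (h 0%N)) ^+ 2 <= normc (u (h k)) ^+ 2.
  rewrite lerXn2r ?nnegrE ?normc_ge0//.
  by elim: k => // k IH; exact: le_trans IH (hle k).
have nat_le N : ((normc (u (h 0%N)) ^+ 2 *+ N)%:E <= sqnorm u)%E.
  apply: (@le_trans _ _ (\sum_(0 <= k < N) (normc (u (h k)) ^+ 2)%:E)%E).
    rewrite sumEFin lee_fin -[X in _ *+ X]subn0 -sumr_const_nat ler_sum//.
  apply: (le_trans (nneseries_lim_ge N (fun k _ => _))).
    by move=> k _; rewrite lee_fin sqr_ge0.
  rewrite nneseries_esumT; last by move=> k; rewrite lee_fin sqr_ge0.
  have <- : \esum_(n in range h) (normc (u n) ^+ 2)%:E =
      \esum_(k in [set: nat]) (normc (u (h k)) ^+ 2)%:E.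
    by rewrite esum_image//; move=> ? ? _ _ /inj_h.
  rewrite [leRHS](esumID (range h)); last by move=> *; rewrite lee_fin sqr_ge0.
  rewrite setTI leeDl//.
  by apply: esum_ge0 => *; rewrite lee_fin sqr_ge0.
have := nat_le (Num.bound (fine (sqnorm u) / normc (u (h 0%N)) ^+ 2)).
apply/negP; rewrite -ltNge -(fineK (sqnorm_fin u)) lte_fin -mulr_natl.
by rewrite -ltr_pdivrMr// archi_boundP// divr_ge0 ?sqr_ge0// fine_ge0// sqnorm_ge0.
Qed.

(** A Fatou argument: each finite partial sum of |g n|^2 is a limit of partial sums bounded by
    M^2. *)
Lemma l2_pointwise_limit (u : nat -> l2 R) (g : int -> R[i]) (M : R) :
  0 <= M -> (forall K, l2norm_re (u K) <= M) ->
  (forall n, (fun K => complex.Re (u K n)) @ \oo --> complex.Re (g n)) ->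
  (forall n, (fun K => complex.Im (u K n)) @ \oo --> complex.Im (g n)) ->
  exists2 v : l2 R, l2val v = g & l2norm_re v <= M.
Proof.
move=> M0 uM uRe uIm.
have gM : (sqnorm g <= (M ^+ 2)%:E)%E.
  apply: ge_ereal_sup => _ [A [finA _] <-].
  rewrite fsbig_finite//= sumEFin lee_fin.
  have cvg_sq n : (fun K => normc (u K n) ^+ 2) @ \oo --> normc (g n) ^+ 2.
    under eq_fun do rewrite normc_sqr.
    rewrite normc_sqr; apply: cvgD; rewrite expr2;
      under eq_fun do rewrite expr2.
    - exact: cvgM.
    - exact: cvgM.
  have cvg_sum : (fun K => \sum_(n <- finmap.enum_fset (fset_set A))
      normc (u K n) ^+ 2) @ \oo -->
      \sum_(n <- finmap.enum_fset (fset_set A)) normc (g n) ^+ 2.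
    by apply: cvg_big => [|n _]; [exact: add_continuous|exact: cvg_sq].
  apply: (cvgr_to_le cvg_sum); apply: nearW => K.
  rewrite -lee_fin -sumEFin -fsbig_finite//.
  apply: (@le_trans _ _ (sqnorm (u K))); last first.
    by rewrite sqnormE lee_fin lerXn2r ?nnegrE ?l2norm_re_ge0.
  by apply: esum_ge; exists A.
have g2 : g \in @square_summable R.
  by rewrite unfold_in; apply: le_lt_trans gM _; rewrite ltry.
exists (L2 g2) => //.
rewrite -(@ler_pXn2r _ 2)// ?nnegrE ?l2norm_re_ge0//.
by rewrite -lee_fin -sqnormE.
Qed.

(** The telescoping series of the increments converges absolutely by comparison with a geometric
    series. *)
Lemma cvg_geometric_increments (a : nat -> R) (C r : R) : 0 <= r < 1 ->
  (forall K, `|a K.+1 - a K| <= C * r ^+ K) -> cvgn a.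
Proof.
move=> /andP[r0 r1] aC.
have C0 : 0 <= C by have := aC 0%N; rewrite expr0 mulr1; exact: le_trans.
have : cvgn (series (telescope a)).
  apply: normed_cvg; apply: (@series_le_cvg _ _ (geometric C r)).
  - by move=> n; rewrite normr_ge0.
  - by move=> n; rewrite /geometric/= mulr_ge0 ?exprn_ge0.
  - by move=> n; exact: aC.
  - by apply: is_cvg_geometric_series; rewrite ger0_norm.
rewrite telescopeK => cvg_a.
have -> : a = [sequence a n - a 0%N]_n + cst (a 0%N).
  by apply/funext => n; rewrite fctE /= subrK.
by apply: is_cvgD => //; exact: is_cvg_cst.
Qed.

End Sequences.

(** * Inverting 1 - x S^k by a Neumann series *)

Section GeometricSeries.
Variable R : realType.
Implicit Types (u f : l2 R) (x : R[i]).

(** The relation u n = x u (n - k) makes |u| nondecreasing along n, n - k, n - 2 k, and so on. *)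
Lemma shift_sub_id_eq0 (k : int) x u : k != 0 -> normc x <= 1 ->
  u = x *: Defs.shift k u -> u = 0.
Proof.
move=> k0 x1 uE; apply: l2_eqP => n.
rewrite (_ : (0 : l2 R) n = 0)//.
have := @l2_nondecr_eq0 _ u (fun j => n - k *+ j); rewrite mulr0n subr0; apply.
  move=> i j /addrI/oppr_inj; rewrite -[k *+ i]mulr_natr -[k *+ j]mulr_natr.
  by move=> /(mulfI k0); rewrite !natz => -[].
move=> j; rewrite mulrSr opprD addrA {1}uE l2ZE shiftE normcM.
by rewrite ler_piMl ?normc_ge0.
Qed.

Lemma ReDM (a b c : R[i]) : complex.Re (a + b * c) =
  complex.Re a + (complex.Re b * complex.Re c - complex.Im b * complex.Im c).
Proof. by case: a b c => ? ? [? ?] []. Qed.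

Lemma ImDM (a b c : R[i]) : complex.Im (a + b * c) =
  complex.Im a + (complex.Re b * complex.Im c + complex.Im b * complex.Re c).
Proof. by case: a b c => ? ? [? ?] []. Qed.

(** The iterates of u -> f + x S^k u from 0 are the partial sums of the Neumann series. They are
    bounded in norm and converge geometrically in each coordinate, so their pointwise limit lies in
    l2 and solves the equation. Injectivity makes the chosen solution linear in f, and the norm
    bound makes it continuous. *)
Lemma continuous_inverse_sub_shift (k : int) x : k != 0 -> normc x < 1 ->
  exists2 G : l2 R -> l2 R, continuous G &
    forall f, G f - x *: Defs.shift k (G f) = f.
Proof.
move=> k0 x1.
have r0 : 0 <= normc x by exact: normc_ge0.
have q0 : 0 < 1 - normc x by rewrite subr_gt0.
have solve f : exists g : l2 R, g - x *: Defs.shift k g = f /\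
    l2norm_re g <= (1 - normc x)^-1 * l2norm_re f.
  pose u := fix u K := if K is K'.+1 then f + x *: Defs.shift k (u K') else 0.
  (* [M] is the fixed point of the norm estimate: |f| + |x| M = M. *)
  pose M := (1 - normc x)^-1 * l2norm_re f.
  have M0 : 0 <= M by rewrite mulr_ge0 ?l2norm_re_ge0 ?invr_ge0 ?ltW.
  have uM K : l2norm_re (u K) <= M.
    elim: K => [|K IH] /=.
      rewrite (_ : l2norm_re 0 = 0)//.
      by apply: complexI; rewrite -l2norm_reE normr0.
    apply: le_trans (l2norm_reD _ _) _.
    rewrite l2norm_reZ l2norm_re_shift.
    have : normc x * l2norm_re (u K) <= normc x * M by rewrite ler_wpM2l.
    have : l2norm_re f = (1 - normc x) * M by rewrite mulrA mulfV ?mul1r// gt_eqF.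
    lra.
  have du K : l2norm_re (u K.+1 - u K) <= l2norm_re f * normc x ^+ K.
    elim: K => [|K IH] /=; first by rewrite linear0 scaler0 addr0 subr0 mulr1.
    have -> : f + x *: Defs.shift k (f + x *: Defs.shift k (u K)) -
        (f + x *: Defs.shift k (u K)) = x *: Defs.shift k (u K.+1 - u K).
      by rewrite /= linearB/= scalerBr opprD addrACA subrr add0r.
    by rewrite l2norm_reZ l2norm_re_shift exprS mulrCA ler_wpM2l.
  have dun K n : normc (u K.+1 n - u K n) <= l2norm_re f * normc x ^+ K.
    exact: le_trans (normc_coord_le (u K.+1 - u K) n) (du K).
  have Re_cvg n : cvgn (fun K => complex.Re (u K n)).
    apply: (@cvg_geometric_increments _ _ (l2norm_re f) (normc x)).
      by rewrite r0 x1.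
    move=> K; apply: le_trans (dun K n).
    case: (u K.+1 n) (u K n) => a b [c d] /=.
    by rewrite -sqrtr_sqr ler_wsqrtr// lerDl sqr_ge0.
  have Im_cvg n : cvgn (fun K => complex.Im (u K n)).
    apply: (@cvg_geometric_increments _ _ (l2norm_re f) (normc x)).
      by rewrite r0 x1.
    move=> K; apply: le_trans (dun K n).
    case: (u K.+1 n) (u K n) => a b [c d] /=.
    by rewrite -sqrtr_sqr ler_wsqrtr// lerDr sqr_ge0.
  pose gRe n := limn (fun K => complex.Re (u K n)).
  pose gIm n := limn (fun K => complex.Im (u K n)).
  have [g gE gM] := @l2_pointwise_limit _ u (fun n => gRe n +i* gIm n) M M0 uM
    Re_cvg Im_cvg.
  exists g; split=> //; apply/eqP; rewrite subr_eq; apply/eqP/l2_eqP => n.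
  have gnE m : g m = gRe m +i* gIm m by rewrite gE.
  rewrite !l2E shiftE !gnE.
  (* The recursion passes to the limit in each coordinate, first for real and then for imaginary
     parts. *)
  have -> : gRe n = complex.Re (f n) + (complex.Re x * gRe (n - k) -
      complex.Im x * gIm (n - k)).
    apply: (@cvg_unique _ (@Rhausdorff R) ((fun K => complex.Re (u K.+1 n)) @ \oo)).
      have : (fun K => complex.Re (u K n)) @ \oo --> gRe n by exact: Re_cvg.
      by rewrite -(cvg_shiftS (fun K => complex.Re (u K n))).
    rewrite (_ : (fun K => _) = fun K => complex.Re (f n) +
      (complex.Re x * complex.Re (u K (n - k)) -
       complex.Im x * complex.Im (u K (n - k)))); last first.
      by apply/funext => K; rewrite -ReDM.
    by apply: cvgD; [exact: cvg_cst|apply: cvgB; apply: cvgM;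
      [exact: cvg_cst|exact: Re_cvg|exact: cvg_cst|exact: Im_cvg]].
  have -> : gIm n = complex.Im (f n) + (complex.Re x * gIm (n - k) +
      complex.Im x * gRe (n - k)).
    apply: (@cvg_unique _ (@Rhausdorff R) ((fun K => complex.Im (u K.+1 n)) @ \oo)).
      have : (fun K => complex.Im (u K n)) @ \oo --> gIm n by exact: Im_cvg.
      by rewrite -(cvg_shiftS (fun K => complex.Im (u K n))).
    rewrite (_ : (fun K => _) = fun K => complex.Im (f n) +
      (complex.Re x * complex.Im (u K (n - k)) +
       complex.Im x * complex.Re (u K (n - k)))); last first.
      by apply/funext => K; rewrite -ImDM.
    by apply: cvgD; [exact: cvg_cst|apply: cvgD; apply: cvgM;
      [exact: cvg_cst|exact: Im_cvg|exact: cvg_cst|exact: Re_cvg]].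
  by apply/eqP; rewrite eq_complex ReDM ImDM/= !eqxx.
have [G G_] := choice solve.
have T_lin : linear (fun u => u - x *: Defs.shift k u).
  move=> a u v; rewrite linearP !scalerDr !scalerA opprD addrACA.
  by rewrite scalerN scalerA [x * a]mulrC.
pose T : {linear l2 R -> l2 R} := HB.pack (fun u => u - x *: Defs.shift k u)
  (GRing.isLinear.Build _ _ _ *:%R _ T_lin).
have T0 u : T u = 0 -> u = 0.
  move=> /(congr1 (fun v => v + x *: Defs.shift k u)); rewrite subrK add0r.
  exact: shift_sub_id_eq0 (ltW x1).
have TG : cancel G T by move=> f; case: (G_ f).
pose G' : {linear l2 R -> l2 R} := HB.pack G
  (GRing.isLinear.Build _ _ _ *:%R G (right_inverse_linear T0 TG)).
exists G; last by move=> f; case: (G_ f).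
apply: (@bounded_linear_continuous _ _ _ G'); apply/linear_boundedP.
near=> r => u.
apply: (@le_trans _ _ (((1 - normc x)^-1)%:C * `|u|)).
  by rewrite !l2norm_reE -rmorphM/= lecR; case: (G_ u).
rewrite ler_wpM2r//; near: r; apply: nbhs_pinfty_ge.
by rewrite complex_real.
Unshelve. all: by end_near. Qed.

End GeometricSeries.

(** * The operator in coordinates *)

Section Tails.
Variable R : realType.
Implicit Types (u f : l2 R) (x : R[i]).

Lemma square_summable_flip u : (fun n => u (- n)) \in @square_summable R.
Proof.
rewrite unfold_in; have := l2P u; rewrite /square_summable /sqnorm.
by rewrite (@reindex_esum _ _ _ [set: int] [set: int] -%R).
Qed.

(** This reflection commutes with [H], so the left half-line is handled by applying results on the
    right one to reflected sequences. *)
Definition flip u : l2 R := L2 (square_summable_flip u).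

Lemma flipE u n : flip u n = u (- n). Proof. by []. Qed.

(* g_n = u_(n+1) - x u_n satisfies g_(n-1) = x g_n, so |g_n| is nondecreasing. *)
Lemma decaying_solution u x (m : int) : x != 0 -> normc x <= 1 ->
  (forall n, m < n -> u (n + 1) + u (n - 1) = (x + x^-1) * u n) ->
  u (m + 1) = x * u m.
Proof.
move=> x0 x1 urec.
pose g : l2 R := Defs.shift (-1) u - x *: u.
have gE n : g n = u (n + 1) - x * u n by rewrite !l2E shiftE opprK.
have gS n : m < n -> g n = x^-1 * g (n - 1).
  move=> mn; rewrite !gE subrK -[u (n + 1)](addrK (u (n - 1))) urec//.
  by field.
apply/eqP; rewrite -subr_eq0 -gE; apply/eqP.
have := @l2_nondecr_eq0 _ g (fun k => m + k%:Z); rewrite addr0; apply.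
  by move=> i j /addrI[].
move=> k; rewrite [m + k.+1%:Z]addrC [in leRHS]gS ?ltrDr// normcM normcV.
have -> : k.+1%:Z + m - 1 = m + k%:Z by lia.
rewrite ler_peMl ?normc_ge0// invf_ge1//.
by rewrite lt_def normc_ge0 andbT; apply: contra x0 => /eqP/eq0_normc ->.
Qed.

(** This is x^(n-1) on n > 0, extended by 0. Taking it as (1 - x S)^-1 e_1 gives square-summability
    at once; at n <= 0 one has w n = x w (n - 1), so |w| does not decrease leftwards and must
    vanish. *)
Lemma geometric_tail x : normc x < 1 -> exists phi : l2 R,
  [/\ phi 1 = 1, forall n : int, n <= 0 -> phi n = 0 &
      forall n : int, 0 < n -> phi (n + 1) = x * phi n].
Proof.
move=> x1; have [//|G _ G1] := @continuous_inverse_sub_shift R 1 x _ x1.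
pose w := G (e_ 1).
have wE n : w n = x * w (n - 1) + (n == 1)%:R.
  have := congr1 (fun v : l2 R => v n) (G1 (e_ 1)).
  by rewrite -/w !l2E shiftE /= => <-; ring.
have w0 n : n <= 0 -> w n = 0.
  move=> n0; have := @l2_nondecr_eq0 _ w (fun k => n - k%:Z).
  rewrite subr0; apply; first by move=> i j /addrI/oppr_inj[].
  move=> k; rewrite wE (_ : _ == 1 = false) ?addr0; last first.
    by apply/negbTE; lia.
  have -> : n - k%:Z - 1 = n - k.+1%:Z by lia.
  by rewrite normcM ler_piMl ?normc_ge0// ltW.
exists w; split=> //; first by rewrite wE subrr w0// mulr0 add0r.
by move=> n n0; rewrite wE addrK (_ : _ == 1 = false) ?addr0//; lia.
Qed.

End Tails.

Section Coordinates.
Variables (R : realType) (lam lam1 mu mu1 : R).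
Implicit Types f : l2 R.
Local Notation L := lam%:C.
Local Notation L1 := lam1%:C.
Local Notation M := mu%:C.
Local Notation M1 := mu1%:C.
Local Notation H := (opH lam lam1 mu mu1).

Lemma opHE f n : H f n = - L * (f (n - 1) - 2 * f n + f (n + 1)) +
  (f 0 * (- L1 * ((n == 1)%:R - 2 * (n == 0)%:R + (n == -1)%:R) + M * (n == 0)%:R)
   + f 1 * (- L1 * (n == 0)%:R + M1 * (n == 1)%:R)
   + f (-1) * (- L1 * (n == 0)%:R + M1 * (n == -1)%:R)).
Proof. by rewrite /opH /opH0 /opH1 !(l2E, shiftE) opprK. Qed.

Lemma opHE0 f : H f 0 =
  (2 * L + 2 * L1 + M) * f 0 - (L + L1) * (f 1 + f (-1)).
Proof. by rewrite opHE /= sub0r add0r; ring. Qed.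

Lemma opHE1 f : H f 1 = (2 * L + M1) * f 1 - L * f 2 - (L + L1) * f 0.
Proof. by rewrite opHE /= subrr; ring. Qed.

Lemma opHE_far f (n : int) : 1 < `|n| ->
  H f n = - L * (f (n - 1) - 2 * f n + f (n + 1)).
Proof.
move=> n1; rewrite opHE.
have [-> [-> ->]] : (n == 1) = false /\ (n == 0) = false /\ (n == -1) = false.
  by split; last split; apply/negbTE; lia.
by rewrite /=; ring.
Qed.

Lemma opH_flip f : H (flip f) = flip (H f).
Proof.
apply: l2_eqP => n; rewrite flipE !opHE !flipE oppr0 opprK.
rewrite !eqr_oppLR opprK oppr0 opprB opprD [- n - 1]addrC.
by rewrite [1 - n]addrC [-1 - n]addrC; ring.
Qed.

End Coordinates.

Lemma linear_comb3 (K : pzRingType) (V W : lmodType K) (T : {linear V -> W})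
    (a b c : K) (u v w : V) :
  T (a *: u + b *: v + c *: w) = a *: T u + b *: T v + c *: T w.
Proof. by rewrite !linearD !linearZ. Qed.

Section Eigenvectors.
Variables (R : realType) (lam lam1 mu mu1 : R).
Implicit Types (f u : l2 R) (x : R[i]).
Local Notation L := lam%:C.
Local Notation L1 := lam1%:C.
Local Notation M := mu%:C.
Local Notation M1 := mu1%:C.
Local Notation A := (L + L1).
Local Notation H := (opH lam lam1 mu mu1).

(* H0 maps x^n to zeta x * x^n. *)
Definition zeta x : R[i] := L * (2 - x - x^-1).
(* If f_(n+1) = x f_n for n >= 1, and symmetrically for n <= -1, then H f = zeta x f
   amounts to side_coef x * f_(+-1) = (lam + lam1) f_0 at the sites 1 and -1 and to
   center_coef x * f_0 = (lam + lam1) (f_1 + f_(-1)) at 0. *)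
Definition side_coef x : R[i] := M1 + L * x^-1.
Definition center_coef x : R[i] := 2 * L1 + M + L * (x + x^-1).

Lemma int_central_cases (n : int) :
  [\/ n = 0, n = 1, n = -1 | 1 < `|n|].
Proof.
have [->|n0] := eqVneq n 0; first by constructor 1.
have [->|n1] := eqVneq n 1; first by constructor 2.
have [->|n2] := eqVneq n (-1); first by constructor 3.
by constructor 4; lia.
Qed.

Lemma int_sign_cases (n : int) : [\/ n = 0,
  exists k : nat, n = - (k%:Z + 1) | exists k : nat, n = k%:Z + 1].
Proof.
have [n0|n0|->] := ltgtP n 0; last by constructor 1.
- by constructor 2; exists (`|n|%N.-1); lia.
- by constructor 3; exists (`|n|%N.-1); lia.
Qed.

Lemma opH_e0 x : x != 0 ->
  H (e_ 0) - zeta x *: e_ 0 = center_coef x *: e_ 0 - A *: (e_ 1 + e_ (-1)).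
Proof.
move=> x0; apply: l2_eqP => n.
change (H (e_ 0) n - zeta x * (n == 0)%:R =
  center_coef x * (n == 0)%:R - A * ((n == 1)%:R + (n == -1)%:R)).
have [->|->|->|n1] := int_central_cases n.
- by rewrite opHE0 /= /zeta /center_coef; ring.
- by rewrite opHE1 /= /zeta /center_coef; ring.
- rewrite -[-1]/(- (1 : int)) -flipE -opH_flip opHE1 !flipE /=.
  by rewrite /zeta /center_coef; ring.
- rewrite opHE_far//=.
  have [-> [-> [-> [-> ->]]]] : (n == 0) = false /\ (n == 1) = false /\
    (n == -1) = false /\ (n - 1 == 0) = false /\ (n + 1 == 0) = false.
    by do !split; apply/negbTE; lia.
  by rewrite /=; ring.
Qed.

Section Tail.
Variables (x : R[i]) (phi : l2 R).
Hypotheses (x0 : x != 0) (phi1 : phi 1 = 1)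
  (phi_le0 : forall n : int, n <= 0 -> phi n = 0)
  (phiS : forall n : int, 0 < n -> phi (n + 1) = x * phi n).

(** The tail solves the equation beyond site 1 and vanishes up to site 0, so a residue remains only
    at the sites 0 and 1. *)
Lemma opH_tail : H phi - zeta x *: phi = side_coef x *: e_ 1 - A *: e_ 0.
Proof.
have phi2 : phi 2 = x by rewrite (phiS (n := 1))// phi1 mulr1.
apply: l2_eqP => n.
change (H phi n - zeta x * phi n = side_coef x * (n == 1)%:R - A * (n == 0)%:R).
have [->|->|->|n1] := int_central_cases n.
- by rewrite opHE0 /= phi1 !phi_le0//; ring.
- by rewrite opHE1 /= phi1 phi2 phi_le0// /zeta /side_coef; field.
- rewrite -[-1]/(- (1 : int)) -flipE -opH_flip opHE1 !flipE /= oppr0 !phi_le0//.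
  by ring.
- rewrite opHE_far//=.
  have [-> ->] : (n == 0) = false /\ (n == 1) = false.
    by do !split; apply/negbTE; lia.
  have [n0|n0] := ltP n 0.
    by rewrite /= !phi_le0; try lia; ring.
  rewrite phiS; last lia.
  have -> : phi n = x * phi (n - 1) by rewrite -phiS ?subrK//; lia.
  by rewrite /zeta /=; field.
Qed.

(** A 3 x 3 system for (a, b, c): its kernel yields the eigenvectors, and solving it with a
    right-hand side yields the resolvent. *)
Lemma opH_tails (a b c : R[i]) : let f := a *: phi + b *: flip phi + c *: e_ 0 in
  H f - zeta x *: f = (a * side_coef x - c * A) *: e_ 1 +
    (b * side_coef x - c * A) *: e_ (-1) + (c * center_coef x - (a + b) * A) *: e_ 0.
Proof.
have opH_tailN : H (flip phi) - zeta x *: flip phi =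
    side_coef x *: e_ (-1) - A *: e_ 0.
  rewrite opH_flip -[RHS](_ : flip (side_coef x *: e_ 1 - A *: e_ 0) = _).
    by rewrite -opH_tail; move: (H phi) => p; apply: l2_eqP.
  by apply: l2_eqP => n; rewrite flipE !l2E /= !eqr_oppLR oppr0.
move=> f.
have -> : H f = a *: H phi + b *: H (flip phi) + c *: H (e_ 0).
  exact: (linear_comb3 (H : {linear l2 R -> l2 R})).
transitivity (a *: (H phi - zeta x *: phi) +
    b *: (H (flip phi) - zeta x *: flip phi) +
    c *: (H (e_ 0) - zeta x *: e_ 0)).
  move: (H phi) (H (flip phi)) (H (e_ 0)) => p q r.
  by apply: l2_eqP => n; rewrite !l2E; ring.
rewrite opH_tail opH_tailN opH_e0//.
by apply: l2_eqP => n; rewrite !l2E; ring.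
Qed.

End Tail.

Lemma eigenvector_tail f x : x != 0 -> normc x <= 1 -> lam != 0 ->
  H f = zeta x *: f -> forall n : int, 0 < n -> f (n + 1) = x * f n.
Proof.
move=> x0 x1 l0 Hf n n0; apply: decaying_solution => // m nm.
have := congr1 (fun v : l2 R => v m) Hf; rewrite opHE_far; last lia.
rewrite l2E /zeta -[- L * _]/(- L * _) mulNr -mulrN -mulrA.
have LC : L != 0 by apply: contra l0 => /eqP/complexI ->.
move=> /(mulfI LC) h; rewrite -[LHS]opprK.
have -> : - (f (m + 1) + f (m - 1)) = - (f (m - 1) - 2 * f m + f (m + 1)) - 2 * f m.
  by ring.
by rewrite h; ring.
Qed.

Lemma eigenvector_equations f x : x != 0 -> normc x <= 1 -> lam != 0 ->
  H f = zeta x *: f ->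
  [/\ side_coef x * f 1 = A * f 0, side_coef x * f (-1) = A * f 0 &
      center_coef x * f 0 = A * (f 1 + f (-1))].
Proof.
move=> x0 x1 l0 Hf.
(* Stated for an arbitrary solution, so that the reflection of [f] supplies the equation at site
   -1. *)
have site1 (g : l2 R) : H g = zeta x *: g -> side_coef x * g 1 = A * g 0.
  move=> Hg; have := congr1 (fun v : l2 R => v 1) Hg.
  rewrite opHE1 l2E (_ : g 2 = x * g 1); last first.
    by rewrite -(eigenvector_tail x0 x1 l0 Hg).
  move=> h; apply/eqP; rewrite -subr_eq0; apply/eqP.
  transitivity ((2 * L + M1) * g 1 - L * (x * g 1) - A * g 0 - zeta x * g 1).
    by rewrite /side_coef /zeta; ring.
  by rewrite h subrr.
split; first exact: site1.
- have := site1 (flip f); rewrite !flipE oppr0; apply.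
  by rewrite opH_flip Hf; apply: l2_eqP => n.
- have := congr1 (fun v : l2 R => v 0) Hf.
  rewrite opHE0 l2E => h; apply/eqP; rewrite -subr_eq0; apply/eqP.
  transitivity ((2 * L + 2 * L1 + M) * f 0 - A * (f 1 + f (-1)) - zeta x * f 0).
    by rewrite /center_coef /zeta; ring.
  by rewrite h subrr.
Qed.

Lemma eigenvector_powers f x : x != 0 -> normc x <= 1 -> lam != 0 ->
  H f = zeta x *: f -> forall k : nat,
  f (k%:Z + 1) = x ^+ k * f 1 /\ f (- (k%:Z + 1)) = x ^+ k * f (-1).
Proof.
move=> x0 x1 l0 Hf.
have powers (g : l2 R) (k : nat) : H g = zeta x *: g -> g (k%:Z + 1) = x ^+ k * g 1.
  move=> Hg; elim: k => [|k IH]; first by rewrite add0r mul1r.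
  have -> : k.+1%:Z + 1 = (k%:Z + 1) + 1 by lia.
  by rewrite (eigenvector_tail x0 x1 l0 Hg) ?IH ?exprS ?mulrA//; lia.
move=> k; split; first exact: powers.
have := powers (flip f) k; rewrite !flipE; apply.
by rewrite opH_flip Hf; apply: l2_eqP => n.
Qed.

Lemma eigenvector_ext f u x : x != 0 -> normc x <= 1 -> lam != 0 ->
  H f = zeta x *: f -> H u = zeta x *: u ->
  f 0 = u 0 -> f 1 = u 1 -> f (-1) = u (-1) -> f = u.
Proof.
move=> x0 x1 l0 Hf Hu e0 e1 eN1; apply: l2_eqP => n.
have Pf := eigenvector_powers x0 x1 l0 Hf.
have Pu := eigenvector_powers x0 x1 l0 Hu.
have [->//|[k ->]|[k ->]] := int_sign_cases n.
- by rewrite (Pf _).2 (Pu _).2 eN1.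
- by rewrite (Pf _).1 (Pu _).1 e1.
Qed.

(** For |x| = 1 the tails have constant modulus, so f_1 = f_(-1) = 0; the equation at site 1 then
    gives (lam + lam1) f_0 = 0. *)
Lemma no_embedded_eigenvector f x : lam != 0 -> lam + lam1 != 0 ->
  normc x = 1 -> H f = zeta x *: f -> f = 0.
Proof.
move=> l0 A0 x1 Hf.
have x0 : x != 0.
  by apply/eqP => xE; move: x1; rewrite xE normc0 => /eqP; rewrite eq_sym oner_eq0.
have x1' : normc x <= 1 by rewrite x1.
have AC : A != 0 by rewrite -rmorphD /=; apply: contra A0 => /eqP/complexI ->.
have f1 (g : l2 R) : H g = zeta x *: g -> g 1 = 0.
  move=> Hg.
  have := @l2_nondecr_eq0 _ g (fun k => k%:Z + 1); apply.
    by move=> i j /addIr[].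
  move=> k; rewrite (_ : k.+1%:Z + 1 = (k%:Z + 1) + 1); last lia.
  rewrite (eigenvector_tail x0 x1' l0 Hg (n := k%:Z + 1)); last lia.
  by rewrite normcM x1 mul1r.
have HN : H (flip f) = zeta x *: flip f.
  by rewrite opH_flip Hf; apply: l2_eqP => n.
have [h1 _ _] := eigenvector_equations x0 x1' l0 Hf.
have f0 : f 0 = 0 by apply: (mulfI AC); rewrite -h1 (f1 f)// !mulr0.
apply: (eigenvector_ext x0 x1' l0 Hf).
- by rewrite linear0 scaler0.
- exact: f0.
- exact: f1 Hf.
- by have := f1 _ HN; rewrite flipE.
Qed.

End Eigenvectors.

(** * Eigenvectors and resolvent *)

Lemma geometric_multiplicity1 (K : numFieldType) (V : normedModType K)
    (T : {linear V -> V}) z (v : V) : v != 0 -> Defs.eigenspace T z v ->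
  (forall f, Defs.eigenspace T z f -> exists a, f = a *: v) ->
  geometric_multiplicity T z 1.
Proof.
move=> v0 Tv colinear; exists (fun=> v); split=> // f /colinear[a ->].
exists [ffun=> a]; split; first by rewrite big_ord1 ffunE.
move=> c; rewrite big_ord1 => /eqP; rewrite -subr_eq0 -scalerBl scaler_eq0.
rewrite (negPf v0) orbF subr_eq0 => /eqP ->.
by apply/ffunP => i; rewrite ffunE (ord1 i).
Qed.

Lemma eigenspaceZ (K : numFieldType) (V : normedModType K)
    (T : {linear V -> V}) z a f :
  Defs.eigenspace T z f -> Defs.eigenspace T z (a *: f).
Proof.
by rewrite /Defs.eigenspace /= linearZ /= => ->; rewrite !scalerA mulrC.
Qed.

Lemma continuous_add_rank3 (K : numFieldType) (V : normedModType K)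
    (p q r : V -> K^o) (u v w : V) :
  continuous p -> continuous q -> continuous r ->
  continuous (fun f => f + (p f *: u + q f *: v + r f *: w)).
Proof.
move=> cp cq cr f; apply: cvgD; first exact: cvg_id.
by apply: cvgD; [apply: cvgD|]; apply: cvgZr_tmp; [exact: cp|exact: cq|exact: cr].
Qed.

Section Spectrum.
Variables (R : realType) (lam lam1 mu mu1 : R).
Implicit Types (f u : l2 R) (x z : R[i]).
Local Notation L := lam%:C.
Local Notation L1 := lam1%:C.
Local Notation M := mu%:C.
Local Notation M1 := mu1%:C.
Local Notation A := (L + L1).
Local Notation H := (opH lam lam1 mu mu1).
Local Notation side_coef := (side_coef lam mu1).
Local Notation center_coef := (center_coef lam lam1 mu).
Local Notation zeta := (zeta lam).
Hypotheses (lam_gt0 : 0 < lam) (A_neq0 : lam + lam1 != 0).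

Let lam0 : lam != 0. Proof. by rewrite gt_eqF. Qed.

Let L0 : L != 0.
Proof. by move: lam0; apply: contra => /eqP/complexI ->. Qed.

Let AC : A != 0.
Proof. by rewrite -rmorphD /=; move: A_neq0; apply: contra => /eqP/complexI ->. Qed.

(** The equation amounts to x + 1/x = 2 c, with roots c + q and c - q of product 1, so one of them
    lies in the closed unit disc. *)
Lemma zeta_surj z : exists x, [/\ x != 0, normc x <= 1 & z = zeta x].
Proof.
pose c := (2 - z / L) / 2; pose q := sqrtc (c ^+ 2 - 1).
have cq : (c + q) * (c - q) = 1.
  by rewrite mulrC -subr_sqr /q sqr_sqrtc; ring.
have nonzero (x y : R[i]) : x * y = 1 -> x != 0.
  move=> xy; apply/eqP => x0; move: xy.
  by rewrite x0 mul0r => /eqP; rewrite eq_sym oner_eq0.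
have zE (x y : R[i]) : x * y = 1 -> x + y = 2 * c -> z = zeta x.
  move=> xy xDy; have x0 := nonzero x y xy.
  have yE : y = x^-1 by apply: (mulfI x0); rewrite xy mulfV.
  by rewrite /zeta -addrA -opprD -yE xDy /c; field.
have [le1|gt1] := leP (normc (c + q)) 1.
  by exists (c + q); split; [exact: nonzero cq| |apply: (zE _ _ cq); ring].
have qc : (c - q) * (c + q) = 1 by rewrite mulrC.
exists (c - q); split; [exact: nonzero qc| |apply: (zE _ _ qc); ring].
have := congr1 (@normc R) cq; rewrite normcM normc1 => h.
have := normc_ge0 (c - q); nra.
Qed.

(** On the unit circle 1/x is the conjugate of x, so zeta x = lam (2 - 2 Re x). *)
Lemma zeta_unit x : normc x = 1 ->
  exists2 t : R, 0 <= t <= 4 * lam & zeta x = t%:C.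
Proof.
move=> x1; have := congr1 (fun r => r ^+ 2) x1; rewrite normc_sqr expr1n.
case: x {x1} => a b /= ab; exists (lam * (2 - 2 * a)).
  by have := lam_gt0; nra.
apply/eqP; rewrite /zeta eq_complex /= ab.
by apply/andP; split; apply/eqP; field.
Qed.

(* For Im x > 0 and |x| < 1 both side_coef x and center_coef x have negative imaginary
   part, so their product cannot be positive; likewise for Im x < 0. *)
Lemma Im_root_eq0 x : x != 0 -> normc x < 1 ->
  side_coef x = 0 \/ side_coef x * center_coef x = 2 * A ^+ 2 -> complex.Im x = 0.
Proof.
move=> x0 x1.
have nx : 0 < normc x ^+ 2 < 1.
  rewrite exprn_gt0 ?expr_lt1 ?normc_ge0//.
  by rewrite lt_def normc_ge0 andbT; apply: contra x0 => /eqP/eq0_normc ->.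
move: nx; rewrite normc_sqr {x0 x1}; case: x => a b /= /andP[].
set n := _ + _ => n0 n1 root; apply: contrapT => /eqP b0.
have q0 : lam * b / n != 0.
  by rewrite !mulf_neq0 ?invr_eq0 // gt_eqF.
pose p := mu1 + lam * (a / n).
pose r := 2 * lam1 + mu + lam * (a + a / n).
have sideE : side_coef (a +i* b) = p +i* (- (lam * b / n)).
  by apply/eqP; rewrite eq_complex /= -/n; apply/andP; split; apply/eqP; rewrite /p; ring.
have centerE : center_coef (a +i* b) = r +i* (- (lam * b / n * (1 - n))).
  by apply/eqP; rewrite eq_complex /= -/n; apply/andP; split; apply/eqP;
     rewrite /r; field; rewrite gt_eqF.
case: root; rewrite sideE.
  by move=> /eqP; rewrite eq_complex /= oppr_eq0 (negPf q0) andbF.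
rewrite centerE -rmorphD -rmorphXn => /eqP; rewrite eq_complex /= {sideE centerE}.
move: (lam * b / n) q0 @p @r => q q0 p r /andP[/eqP h1 /eqP h2].
have {}h1 : p * r - q * (q * (1 - n)) = 2 * (lam + lam1) ^+ 2 by lra.
have {}h2 : p * - (q * (1 - n)) + - q * r = 0 by lra.
(* This is -p times the imaginary part of the equation, with p r eliminated through the real part.
   The bracket is positive, contradicting q != 0. *)
have h : q * ((1 - n) * (p ^+ 2 + q ^+ 2) + 2 * (lam + lam1) ^+ 2) = 0.
  rewrite -h1; transitivity (- p * (p * - (q * (1 - n)) + - q * r)); first by ring.
  by rewrite h2 mulr0.
have : 0 < (1 - n) * (p ^+ 2 + q ^+ 2) + 2 * (lam + lam1) ^+ 2.
  rewrite ltr_wpDl//; last by rewrite mulr_gt0// exprn_even_gt0.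
  by apply: mulr_ge0; [lra|rewrite addr_ge0 ?sqr_ge0].
by move: h => /eqP; rewrite mulf_eq0 (negPf q0) => /eqP ->; rewrite ltxx.
Qed.

(** * Energies with parameter in the open unit disc *)

Section Inside.
Variable x : R[i].
Hypotheses (x0 : x != 0) (x1 : normc x < 1).

Let x1' : normc x <= 1. Proof. exact: ltW. Qed.

(** The difference of [phi] and its reflection is an eigenvector. Conversely the equation at site 1
    forces f_0 = 0, and the one at 0 then gives f_(-1) = - f_1. *)
Lemma odd_eigenvectors : side_coef x = 0 ->
  is_eigenvalue H (zeta x) /\ simple_odd H (zeta x).
Proof.
move=> dx0; have [phi [phi1 phi0 phiS]] := geometric_tail x1.
pose v := 1 *: phi + (-1) *: flip phi + 0 *: e_ 0 : l2 R.
have Hv : H v = zeta x *: v.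
  apply/eqP; rewrite -subr_eq0 /v (opH_tails lam lam1 mu mu1 x0 phi1 phi0 phiS).
  by rewrite dx0 subrr !mul0r !mulr0 !subr0 !scale0r !addr0.
have v1 : v 1 = 1.
  by rewrite /v !l2E flipE phi1 (phi0 (-1))//=; ring.
have vodd f : H f = zeta x *: f -> f 0 = 0 /\ f (-1) = - f 1.
  move=> Hf; have [h1 _ h0] := eigenvector_equations x0 x1' lam0 Hf.
  have f0 : f 0 = 0 by apply: (mulfI AC); rewrite -h1 dx0 mul0r mulr0.
  split=> //; apply/eqP; rewrite -addr_eq0 addrC; apply/eqP; apply: (mulfI AC).
  by rewrite -h0 f0 !mulr0.
have v_neq0 : v != 0.
  by apply/eqP => v0; move: v1; rewrite v0 => /eqP; rewrite eq_sym oner_eq0.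
split; first by exists v.
split.
  apply: (geometric_multiplicity1 v_neq0 Hv) => f Hf; exists (f 1).
  have [f0 fN1] := vodd f Hf; have [v0 vN1] := vodd v Hv.
  apply: (eigenvector_ext x0 x1' lam0 Hf).
  - exact: (eigenspaceZ (T := H) _ Hv).
  - by rewrite l2E v0 f0 mulr0.
  - by rewrite l2E v1 mulr1.
  - by rewrite l2E vN1 v1 fN1 mulrN1.
move=> f Hf n; have [f0 fN1] := vodd f Hf.
have P := eigenvector_powers x0 x1' lam0 Hf.
have [->|[k ->]|[k ->]] := int_sign_cases n; first by rewrite oppr0 f0 oppr0.
- by rewrite opprK (P _).1 (P _).2 fN1 mulrN.
- by rewrite (P _).1 (P _).2 fN1 mulrN opprK.
Qed.

(** The coefficients (A, A, side_coef x) satisfy the equations at 1 and -1 identically, and the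
    hypothesis is the equation at 0. As side_coef x != 0, f_0 determines f_1 and f_(-1), which are
    equal. *)
Lemma even_eigenvectors : side_coef x * center_coef x = 2 * A ^+ 2 ->
  is_eigenvalue H (zeta x) /\ simple_even H (zeta x).
Proof.
move=> de; have [phi [phi1 phi0 phiS]] := geometric_tail x1.
have d0 : side_coef x != 0.
  apply/eqP => d0; move: de; rewrite d0 mul0r => /esym/eqP.
  by rewrite mulf_eq0 pnatr_eq0 expf_eq0 (negPf AC).
pose v := A *: phi + A *: flip phi + side_coef x *: e_ 0 : l2 R.
have Hv : H v = zeta x *: v.
  apply/eqP; rewrite -subr_eq0 /v (opH_tails lam lam1 mu mu1 x0 phi1 phi0 phiS).
  rewrite de [A * side_coef x]mulrC subrr !scale0r !add0r scaler_eq0.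
  by apply/orP; left; apply/eqP; ring.
have v0 : v 0 = side_coef x by rewrite /v !l2E flipE oppr0 phi0//=; ring.
have veven f : H f = zeta x *: f ->
    f 1 = A * f 0 / side_coef x /\ f (-1) = A * f 0 / side_coef x.
  move=> Hf; have [h1 hN1 _] := eigenvector_equations x0 x1' lam0 Hf.
  by split; apply: (mulfI d0); rewrite ?h1 ?hN1; field.
have v_neq0 : v != 0.
  by apply/eqP => vE; move: v0; rewrite vE => /esym/eqP; exact/negP.
split; first by exists v.
split.
  apply: (geometric_multiplicity1 v_neq0 Hv) => f Hf; exists (f 0 / side_coef x).
  have [f1 fN1] := veven f Hf; have [v1 vN1] := veven v Hv.
  apply: (eigenvector_ext x0 x1' lam0 Hf).
  - exact: (eigenspaceZ (T := H) _ Hv).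
  - by rewrite l2E v0 divfK.
  - by rewrite l2E v1 f1 v0; field.
  - by rewrite l2E vN1 fN1 v0; field.
move=> f Hf n; have [f1 fN1] := veven f Hf.
have P := eigenvector_powers x0 x1' lam0 Hf.
have [->|[k ->]|[k ->]] := int_sign_cases n; first by rewrite oppr0.
- by rewrite opprK (P _).1 (P _).2 fN1 f1.
- by rewrite (P _).1 (P _).2 fN1 f1.
Qed.

(** If side_coef x != 0 then f_0 != 0, since otherwise [f] vanishes at -1, 0, 1 and hence
    everywhere. Multiplying the equation at 0 by side_coef x eliminates f_1 and f_(-1). *)
Lemma eigenvalue_inside : is_eigenvalue H (zeta x) ->
  side_coef x = 0 \/ side_coef x * center_coef x = 2 * A ^+ 2.
Proof.
move=> [f f0 Hf]; have [d0|d0] := eqVneq (side_coef x) 0; first by left.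
right; have [h1 hN1 h0] := eigenvector_equations x0 x1' lam0 Hf.
have f00 : f 0 != 0.
  apply/eqP => f00; move: f0; apply/negP; rewrite negbK; apply/eqP.
  apply: (eigenvector_ext x0 x1' lam0 Hf) => //.
  - by have := eigenspaceZ (T := H) 0 Hf; rewrite scale0r.
  - by apply: (mulfI d0); rewrite h1 f00 !mulr0.
  - by apply: (mulfI d0); rewrite hN1 f00 !mulr0.
apply: (mulIf f00); rewrite -mulrA h0.
transitivity (A * (side_coef x * f 1 + side_coef x * f (-1))); first by ring.
by rewrite h1 hN1; ring.
Qed.

Lemma opH0_factor u : opH0 lam u - zeta x *: u = (L / x) *:
  ((u - x *: Defs.shift (-1) u) - x *: Defs.shift 1 (u - x *: Defs.shift (-1) u)).
Proof.
apply: l2_eqP => n; rewrite /opH0 !(l2E, shiftE) opprK subrK /zeta.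
by field.
Qed.

Lemma resolvent_inside : side_coef x != 0 ->
  side_coef x * center_coef x - 2 * A ^+ 2 != 0 -> resolvent_set H (zeta x).
Proof.
move=> d0 D0; have [phi [phi1 phi0 phiS]] := geometric_tail x1.
have [//|G1 cG1 G1K] := @continuous_inverse_sub_shift R 1 x _ x1.
have [//|G2 cG2 G2K] := @continuous_inverse_sub_shift R (-1) x _ x1.
pose B0 f := (x / L) *: G2 (G1 f).
have B0K f : opH0 lam (B0 f) - zeta x *: B0 f = f.
  rewrite opH0_factor /B0.
  have lin k (a : R[i]) (g : l2 R) : a *: g - x *: Defs.shift k (a *: g) =
      a *: (g - x *: Defs.shift k g).
    by apply: l2_eqP => n; rewrite !(l2E, shiftE); ring.
  rewrite !lin G2K G1K scalerA (_ : L / x * (x / L) = 1) ?scale1r//.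
  by field; rewrite x0 L0.
have cB0 : continuous B0.
  move=> f; apply: (@continuousZl_tmp R[i] (l2 R) (l2 R)).
  exact: (@continuous_comp _ _ _ G1 G2 f (cG1 f) (cG2 _)).
(* The solution of (H - zeta x) g = f is sought as u + a phi + b (flip phi) + c e_0
   with u = B0 f; the coefficients solve a 3 x 3 linear system whose right-hand side
   (r1, r1, r0) is the part of u hit by the perturbation H1. *)
pose r1 (p0 p1 : R[i]) := M1 * p1 - L1 * p0.
pose r0 (p0 p1 pN : R[i]) := (2 * L1 + M) * p0 - L1 * (p1 + pN).
(* The equations at 1 and -1 express a and b through c; substituted into the equation at 0 times
   side_coef x, they leave a single equation for c with coefficient [Delta]. *)
pose Delta := side_coef x * center_coef x - 2 * A ^+ 2.
pose c p0 p1 pN := - (r0 p0 p1 pN * side_coef x + A * (r1 p0 p1 + r1 p0 pN)) / Delta.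
pose a p0 p1 pN := (c p0 p1 pN * A - r1 p0 p1) / side_coef x.
pose b p0 p1 pN := (c p0 p1 pN * A - r1 p0 pN) / side_coef x.
pose W p0 p1 pN : l2 R :=
  a p0 p1 pN *: phi + b p0 p1 pN *: flip phi + c p0 p1 pN *: e_ 0.
pose C (u : l2 R) := u + W (u 0) (u 1) (u (-1)).
have opH1E u : opH1 lam1 mu mu1 u = r1 (u 0) (u 1) *: e_ 1 +
    r1 (u 0) (u (-1)) *: e_ (-1) + r0 (u 0) (u 1) (u (-1)) *: e_ 0.
  by apply: l2_eqP => n; rewrite /opH1 /r1 /r0 !l2E; ring.
have cC : continuous C.
  (* The coefficients are linear in u 0, u 1 and u (-1), so [C] is the identity plus a finite-rank
     map built on continuous coordinate functionals. *)
  have -> : C = fun u => u + (u 0 *: W 1 0 0 + u 1 *: W 0 1 0 + u (-1) *: W 0 0 1).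
    apply/funext => u; rewrite /C; congr (_ + _); apply: l2_eqP => n.
    rewrite /W !l2E /a /b /c /r1 /r0; move: (phi n) (flip phi n) => s t.
    by move: (side_coef x)^-1 Delta^-1 (side_coef x) => iD iDelta d; ring.
  by apply: continuous_add_rank3; exact: Defs.coord_continuous.
apply: (@resolvent_setW _ _ _ _ (fun f => C (B0 f))).
- move=> f Hf; apply: contrapT => /eqP f0.
  have : is_eigenvalue H (zeta x) by exists f.
  move=> /eigenvalue_inside[/eqP|/eqP]; first exact/negP.
  by rewrite -subr_eq0; exact/negP.
- by move=> f; exact: (@continuous_comp _ _ _ B0 C f (cB0 f) (cC _)).
move=> f; set u := B0 f.
have sumE (p q r s t : l2 R) : p + q + r - (s + t) = (p - s) + (q + (r - t)).
  by apply: l2_eqP => n; rewrite !l2E; ring.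
have CE : H (C u) - zeta x *: C u = (opH0 lam u - zeta x *: u) +
    (opH1 lam1 mu mu1 u + (H (W (u 0) (u 1) (u (-1))) -
       zeta x *: W (u 0) (u 1) (u (-1)))).
  rewrite /C; move: (W _ _ _) => w.
  have -> : H (u + w) = H u + H w.
    have /= := linear_comb3 (H : {linear l2 R -> l2 R}) 1 1 0 u w 0.
    by rewrite !scale1r !scale0r !addr0.
  by rewrite scalerDr {1}/opH; exact: sumE.
have HW p0 p1 pN : H (W p0 p1 pN) - zeta x *: W p0 p1 pN = _ :=
  opH_tails lam lam1 mu mu1 x0 phi1 phi0 phiS (a p0 p1 pN) (b p0 p1 pN) (c p0 p1 pN).
rewrite CE B0K opH1E HW.
move: (u 0) (u 1) (u (-1)) => p0 p1 pN.
have aE : a p0 p1 pN * side_coef x - c p0 p1 pN * A = - r1 p0 p1 by rewrite /a; field.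
have bE : b p0 p1 pN * side_coef x - c p0 p1 pN * A = - r1 p0 pN by rewrite /b; field.
have cE : c p0 p1 pN * center_coef x - (a p0 p1 pN + b p0 p1 pN) * A = - r0 p0 p1 pN.
  by rewrite /a /b /c /Delta; field; rewrite d0 D0.
by rewrite aE bE cE; apply: l2_eqP => n; rewrite !l2E; ring.
Qed.

End Inside.

End Spectrum.

(** * The discrete spectrum *)

Lemma eigenvalue_spectrum (K : numFieldType) (V : normedModType K)
    (T : {linear V -> V}) z : is_eigenvalue T z -> Defs.spectrum T z.
Proof.
move=> [f f0 Tf] [B [_ BT _]]; move: f0; apply/negP; rewrite negbK.
have {}Tf : T f = z *: f := Tf.
by have := BT f; rewrite Tf subrr linear0 => <-.
Qed.

(** Near an eigenvalue z the spectrum consists of eigenvalues only; the other eigenvalues form a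
    finite, hence closed set, and removing it from a small ball isolates z. *)
Lemma discrete_spectrum_finite (K : numFieldType) (V : normedModType K)
    (T : {linear V -> V}) : finite_set [set z | is_eigenvalue T z] ->
  (forall z, is_eigenvalue T z -> exists m, geometric_multiplicity T z m) ->
  (forall z, is_eigenvalue T z -> exists2 e : K, 0 < e & forall w,
     `|z - w| < e -> Defs.spectrum T w -> is_eigenvalue T w) ->
  discrete_spectrum T = [set z | is_eigenvalue T z].
Proof.
move=> finE mult gap; apply/seteqP; split=> z /=; first by case.
move=> Ez; split=> //; last exact: mult.
split; first by rewrite inE; exact: eigenvalue_spectrum.
have closed_others : closed ([set w | is_eigenvalue T w] `\ z).
  have /accessible_finite_set_closed : accessible_space K.
    exact/hausdorff_accessible/norm_hausdorff.
  by apply; exact: finite_setD.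
have [e e0 gap_e] := gap z Ez.
exists (ball z e `&` ~` ([set w | is_eigenvalue T w] `\ z)).
  apply: filterI; first exact: nbhsx_ballx.
  by apply: open_nbhs_nbhs; split; [exact: closed_openC|move=> []/=].
apply/seteqP; split=> w /=.
  move=> [[ball_w others] sp_w]; apply: contrapT => wz; apply: others.
  by split=> //=; apply: gap_e sp_w; move: ball_w; rewrite -ball_normE.
move=> ->; split; last exact: eigenvalue_spectrum.
by split; [exact: ballxx|case].
Qed.

Section RealParameter.
Variables (R : realType) (lam lam1 mu mu1 : R).
Local Notation H := (opH lam lam1 mu mu1).
Local Notation d := (delta lam mu1).
Local Notation s := (sigma lam lam1 mu).
Local Notation b := ((alpha lam lam1 + 1) ^+ 2).
Hypotheses (lam_gt0 : 0 < lam) (alpha_neqN1 : alpha lam lam1 <> -1).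
Implicit Types y : R.

Let lam0 : lam != 0. Proof. by rewrite gt_eqF. Qed.

Let A_neq0 : lam + lam1 != 0.
Proof.
apply/eqP => A0; apply: alpha_neqN1; rewrite /alpha.
have -> : lam1 = - lam by lra.
by rewrite mulNr divff.
Qed.

(** This is zeta at x = 1/y for real y; the condition |x| < 1 becomes 1 < |y|. *)
Definition energy y : R := lam * (2 - y - y^-1).

Let two : 2 = (2 : R)%:C.
Proof. by rewrite (rmorph_nat (real_complex R)). Qed.

Lemma zetaV y : zeta lam (y^-1)%:C = (energy y)%:C.
Proof.
rewrite /zeta /energy -(fmorphV (real_complex R)) invrK two -!rmorphB -rmorphM.
by rewrite addrAC.
Qed.

Lemma side_coefV y : side_coef lam mu1 (y^-1)%:C = (lam * (d + y))%:C.
Proof. 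
rewrite /side_coef -(fmorphV (real_complex R)) invrK -rmorphM -rmorphD /delta.
by congr (_%:C); field.
 Qed.

Lemma center_coefV y : center_coef lam lam1 mu (y^-1)%:C =
  (lam * (2 * s + (y + y^-1)))%:C.
Proof.
rewrite /center_coef -(fmorphV (real_complex R)) invrK two -!rmorphD -!rmorphM -!rmorphD.
congr (_%:C); rewrite [y^-1 + y]addrC [RHS]mulrDr; congr (_ + _).
by rewrite /sigma; field.
Qed.

Lemma even_conditionE y :
  side_coef lam mu1 (y^-1)%:C * center_coef lam lam1 mu (y^-1)%:C =
    2 * (lam%:C + lam1%:C) ^+ 2
  <-> (d + y) * (2 * s + (y + y^-1)) = 2 * b.
Proof.
rewrite side_coefV center_coefV two -rmorphD -rmorphXn -!rmorphM.
have E1 : lam * (d + y) * (lam * (2 * s + (y + y^-1))) =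
    lam ^+ 2 * ((d + y) * (2 * s + (y + y^-1))) by ring.
have E2 : 2 * (lam + lam1) ^+ 2 = lam ^+ 2 * (2 * b).
  by rewrite /alpha; field.
rewrite E1 E2; split=> [/complexI/(mulfI (expf_neq0 2 lam0))//|->//].
Qed.

Lemma normcV_lt1 y : 1 < `|y| -> (y^-1)%:C != 0 /\ normc (y^-1)%:C < 1.
Proof.
move=> y1; have y0 : y != 0 by rewrite -normr_gt0; lra.
split; first by rewrite fmorph_eq0 invr_eq0.
by rewrite /= expr0n addr0 sqrtr_sqr normfV invf_lt1 ?normr_gt0.
Qed.

(** The parameter x of an eigenvalue is off the unit circle by [no_embedded_eigenvector] and real by
    [Im_root_eq0]; y is its inverse. *)
Lemma is_eigenvalueP (z : R[i]) : is_eigenvalue H z <-> exists y,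
  [/\ 1 < `|y|, z = (energy y)%:C &
     d + y = 0 \/ (d + y) * (2 * s + (y + y^-1)) = 2 * b].
Proof.
split; last first.
  move=> [y [/normcV_lt1[x0 x1] -> hy]]; rewrite -zetaV.
  case: hy => [dy|/even_conditionE de].
  - have side0 : side_coef lam mu1 (y^-1)%:C = 0 by rewrite side_coefV dy mulr0.
    exact: (odd_eigenvectors mu lam_gt0 A_neq0 x0 x1 side0).1.
  - exact: (even_eigenvectors lam_gt0 A_neq0 x0 x1 de).1.
have [x [x0 x1 ->]] := zeta_surj lam_gt0 z.
move: x1; rewrite le_eqVlt => /orP[/eqP x1|x1].
  by move=> [f f0 /(no_embedded_eigenvector lam0 A_neq0 x1) fE]; rewrite fE eqxx in f0.
move=> /(eigenvalue_inside lam_gt0 x0 x1) root.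
have x_re := Im_root_eq0 lam_gt0 A_neq0 x0 x1 root.
have xE : x = ((complex.Re x)^-1^-1)%:C.
  by rewrite invrK; case: x x_re {x0 x1 root} => p q /= ->.
have y0 : complex.Re x != 0 by apply: contra x0 => /eqP y0; rewrite xE y0 !invr0.
exists (complex.Re x)^-1; split.
- rewrite normfV invf_gt1 ?normr_gt0//.
  by move: x1; rewrite {1}xE invrK /= expr0n addr0 sqrtr_sqr.
- by rewrite {1}xE zetaV.
- case: root; rewrite {1}xE.
    by rewrite side_coefV => /eqP; rewrite fmorph_eq0 mulf_eq0 (negPf lam0) => /eqP; left.
  by rewrite [X in center_coef _ _ _ X]xE => /even_conditionE; right.
Qed.

Lemma ltr2_addV y : 1 < y -> 2 < y + y^-1.
Proof. by move=> y1; have := ltr_addV (lexx 1) y1; rewrite invr1. Qed.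

Lemma energy_lt0 y : 1 < y -> energy y < 0.
Proof. by move=> /ltr2_addV y2; rewrite /energy pmulr_rlt0//; lra. Qed.

Lemma energyN_gt y : 1 < y -> 4 * lam < energy (- y).
Proof.
move=> /ltr2_addV y2; rewrite /energy invrN !opprK mulrC ltr_pM2l//; lra.
Qed.

Lemma energy_outside y : 1 < `|y| -> energy y < 0 \/ 4 * lam < energy y.
Proof.
have [y0|y0] := ltP y 0.
  by rewrite ltr0_norm// => y1; right; rewrite -[y]opprK; exact: energyN_gt.
by rewrite ger0_norm// => y1; left; exact: energy_lt0.
Qed.

Lemma simple_even_energy y : 1 < `|y| ->
  (d + y) * (2 * s + (y + y^-1)) = 2 * b -> simple_even H (energy y)%:C.
Proof.
move=> /normcV_lt1[x0 x1] /even_conditionE de; rewrite -zetaV.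
exact: (even_eigenvectors lam_gt0 A_neq0 x0 x1 de).2.
Qed.

Lemma simple_odd_kappa : 1 < `|d| -> simple_odd H (kappa lam mu1)%:C.
Proof.
move=> d1; have d0 : d != 0 by rewrite -normr_gt0; lra.
(* Indeed kappa = lam (2 + d + 1/d), the energy at the root y = - d of the odd equation. *)
have -> : kappa lam mu1 = energy (- d).
  by rewrite /kappa /energy invrN; field.
have /normcV_lt1[x0 x1] : 1 < `|- d| by rewrite normrN.
have side0 : side_coef lam mu1 ((- d)^-1)%:C = 0 by rewrite side_coefV subrr mulr0.
by rewrite -zetaV; exact: (odd_eigenvectors mu lam_gt0 A_neq0 x0 x1 side0).2.
Qed.

Lemma discrete_spectrumE : finite_set [set z | is_eigenvalue H z] ->
  discrete_spectrum H = [set z | is_eigenvalue H z].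
Proof.
move=> finE; apply: discrete_spectrum_finite => // z.
  move=> /is_eigenvalueP[y [y1 -> [dy|hy]]]; exists 1%N; last first.
    by have [] := simple_even_energy y1 hy.
  have dE : d = - y by lra.
  have d1 : 1 < `|d| by rewrite dE normrN.
  have d0 : d != 0 by rewrite -normr_gt0; lra.
  have [] := simple_odd_kappa d1; rewrite (_ : kappa lam mu1 = energy y)//.
  have -> : y = - d by lra.
  by rewrite /kappa /energy invrN; field.
move=> /is_eigenvalueP[y [y1 -> _]].
(* [e] is the distance from the eigenvalue to [0, 4 lam]. A spectral point closer than [e] has its
   parameter in the open disc, where every point outside the resolvent set is an eigenvalue. *)
have [e e0 far] : exists2 e : R, 0 < e &
    forall t, 0 <= t <= 4 * lam -> e <= `|energy y - t|.
  have [h|h] := energy_outside y1.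
    by exists (- energy y) => [|t /andP[t0 _]]; [lra|rewrite ler0_norm; lra].
  by exists (energy y - 4 * lam) => [|t /andP[_ t0]]; [lra|rewrite ger0_norm; lra].
exists e%:C => [|w]; first by rewrite ltcR.
have [x [x0 x1 ->]] := zeta_surj lam_gt0 w.
move: x1; rewrite le_eqVlt => /orP[/eqP x1|x1].
  have [t t4 ->] := zeta_unit lam_gt0 x1.
  rewrite -rmorphB normc_def /= expr0n addr0 sqrtr_sqr ltcR => h.
  by have := far t t4; rewrite leNgt h.
move=> _ sp; apply: contrapT => nE; apply: sp.
apply: resolvent_inside => //; rewrite ?subr_eq0; apply/eqP => h; apply: nE.
- exact: (odd_eigenvectors mu lam_gt0 A_neq0 x0 x1 h).1.
- exact: (even_eigenvectors lam_gt0 A_neq0 x0 x1 h).1.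
Qed.

End RealParameter.

Lemma set_seq1 (T : eqType) (x : T) : [set` [:: x]] = [set x].
Proof. by apply/seteqP; split=> z /=; rewrite inE => /eqP. Qed.

Lemma set_seq2 (T : eqType) (x y : T) : [set` [:: x; y]] = [set x; y].
Proof.
apply/seteqP; split=> z /=; rewrite !inE.
  by move=> /orP[/eqP ->|/eqP ->]; [left|right].
by move=> [->|->]; rewrite eqxx ?orbT.
Qed.

Lemma set_seq3 (T : eqType) (x y z : T) : [set` [:: x; y; z]] = [set x; y; z].
Proof.
apply/seteqP; split=> t /=; rewrite !inE.
  by move=> /or3P[]/eqP ->; [left; left|left; right|right].
by move=> [[->|->]|->]; rewrite eqxx ?orbT.
Qed.

(** * The discrete spectrum as a list of energies *)

Section Lists.
Variables (R : realType) (lam lam1 mu mu1 : R).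
Local Notation H := (opH lam lam1 mu mu1).
Local Notation d := (delta lam mu1).
Local Notation s := (sigma lam lam1 mu).
Local Notation k := (kappa lam mu1).
Local Notation b := ((alpha lam lam1 + 1) ^+ 2).
Hypotheses (lam_gt0 : 0 < lam) (alpha_neqN1 : alpha lam lam1 <> -1).

Lemma alpha1_sqr_gt0 : 0 < b.
Proof.
rewrite exprn_even_gt0//=; apply/eqP => h; apply: alpha_neqN1; lra.
Qed.

Lemma branch_even y : branch d s b y ->
  1 < y /\ (d + y) * (2 * s + (y + y^-1)) = 2 * b.
Proof. by case=> -[]. Qed.

Lemma branchN_even y : branch (- d) (- s) b y ->
  1 < y /\ (d + - y) * (2 * s + (- y + (- y)^-1)) = 2 * b.
Proof. by move=> [] [y1 _ _ <-]; split=> //; rewrite invrN; ring. Qed.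

Lemma simple_even_lo y : branch d s b y -> simple_even H (energy lam y)%:C.
Proof.
move=> /branch_even[y1]; apply: simple_even_energy => //.
by rewrite (lt_le_trans y1)// ler_norm.
Qed.

Lemma simple_even_hi y : branch (- d) (- s) b y -> simple_even H (energy lam (- y))%:C.
Proof.
move=> /branchN_even[y1]; apply: simple_even_energy => //.
by rewrite normrN (lt_le_trans y1)// ler_norm.
Qed.

(** Even roots y > 1 give the energies below 0. Even roots y < -1 are opposites of branch points for
    (- d, - s) and give those above 4 lam. The odd root - d counts when |d| > 1. *)
Lemma discrete_spectrum_branches (lo hi : seq R) :
  (forall y, branch d s b y <-> y \in lo) ->
  (forall y, branch (- d) (- s) b y <-> y \in hi) ->
  discrete_spectrum H = [set` [seq (energy lam y)%:C | y <- lo] ++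
    [seq (energy lam (- y))%:C | y <- hi] ++
    (if 1 < `|d| then [:: k%:C] else [::])].
Proof.
move=> loP hiP.
have b0 := alpha1_sqr_gt0.
suff E : [set z | is_eigenvalue H z] = [set` [seq (energy lam y)%:C | y <- lo] ++
    [seq (energy lam (- y))%:C | y <- hi] ++
    (if 1 < `|d| then [:: k%:C] else [::])].
  by rewrite -E; apply: discrete_spectrumE => //; rewrite E; exact: finite_seq.
have kE : 1 < `|d| -> k = energy lam (- d).
  move=> d1; have d0 : d != 0 by rewrite -normr_gt0; lra.
  by rewrite /kappa /energy invrN; field.
apply/seteqP; split=> z /=.
  move=> /(is_eigenvalueP _ _ lam_gt0 alpha_neqN1)[y [y1 -> hy]].
  rewrite !mem_cat; case: hy => [dy|hy].
    have yE : y = - d by lra.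
    rewrite yE normrN in y1; rewrite y1 yE -kE//.
    by rewrite mem_seq1 eqxx !orbT.
  have [y0|y0] := ltP y 0.
    rewrite ltr0_norm// in y1.
    have /hiP ylo : branch (- d) (- s) b (- y).
      by apply: branchP => //; rewrite -hy invrN; ring.
    have := map_f (fun t => (energy lam (- t))%:C) ylo.
    by rewrite opprK => ->; rewrite orbT.
  rewrite ger0_norm// in y1.
  have /loP ylo : branch d s b y by exact: branchP.
  by rewrite (map_f (fun t => (energy lam t)%:C) ylo).
rewrite !mem_cat => /or3P[/mapP[y /loP hy ->]|/mapP[y /hiP hy ->]|].
- apply/is_eigenvalueP => //; have [y1 ?] := branch_even hy.
  by exists y; split=> //; [rewrite (lt_le_trans y1)// ler_norm|right].
- apply/is_eigenvalueP => //; have [y1 ?] := branchN_even hy.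
  by exists (- y); split=> //; [rewrite normrN (lt_le_trans y1)// ler_norm|right].
- case: ifP => // d1; rewrite mem_seq1 => /eqP ->; apply/is_eigenvalueP => //.
  by exists (- d); split; [rewrite normrN|rewrite kE|left; rewrite subrr].
Qed.

End Lists.

(** * The eigenvalues region by region *)

Theorem theorem2p1 (R : realType) (lam lam1 mu mu1 : R) :
  let H : {linear l2 R -> l2 R} := opH lam lam1 mu mu1 in
  let d := delta lam mu1 in
  let s := sigma lam lam1 mu in
  let k := kappa lam mu1 in
  let p := (alpha lam lam1, d, s) in
  let lower := 2 * lam * (Num.min s ((d ^+ 2 + 1) / (2 * d)) + 1) in
  let upper := 2 * lam * (Num.max s ((d ^+ 2 + 1) / (2 * d)) + 1) in
  0 < lam -> alpha lam lam1 <> -1 ->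
  (* a *)
  (U1_pp p -> exists nu1 nu2 : R,
    [/\ discrete_spectrum H = [set nu1%:C; nu2%:C; k%:C],
        4 * lam < nu1 /\ 4 * lam < nu2,
        [/\ nu1 < lower, lower <= upper & upper < nu2],
        simple_even H nu1%:C /\ simple_even H nu2%:C
      & simple_odd H k%:C]) /\
  (* b *)
  (U0_pp p -> discrete_spectrum H = set0) /\
  (* c *)
  (UN1_pp p -> exists nu1 nu2 : R,
    [/\ discrete_spectrum H = [set nu1%:C; nu2%:C; k%:C],
        nu1 < 0 /\ nu2 < 0,
        [/\ nu1 < lower, lower <= upper & upper < nu2],
        simple_even H nu1%:C /\ simple_even H nu2%:C
      & simple_odd H k%:C]) /\
  (* d *)
  (U_np p ->
    (`|d| <= 1 -> exists nu1 : R,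
      [/\ discrete_spectrum H = [set nu1%:C], 4 * lam < nu1
        & simple_even H nu1%:C]) /\
    (1 < `|d| -> exists nu1 : R,
      [/\ discrete_spectrum H = [set nu1%:C; k%:C], 4 * lam < nu1,
          simple_even H nu1%:C & simple_odd H k%:C])) /\
  (* e *)
  (U_nn p ->
    (`|d| <= 1 -> exists nu1 nu2 : R,
      [/\ discrete_spectrum H = [set nu1%:C; nu2%:C], nu1 < 0, 4 * lam < nu2,
          simple_even H nu1%:C & simple_even H nu2%:C]) /\
    (1 < `|d| -> exists nu1 nu2 : R,
      [/\ discrete_spectrum H = [set nu1%:C; nu2%:C; k%:C],
          nu1 < 0 /\ 4 * lam < nu2,
          simple_even H nu1%:C, simple_even H nu2%:C & simple_odd H k%:C])) /\
  (* f *)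
  (U_pn p ->
    (`|d| <= 1 -> exists nu1 : R,
      [/\ discrete_spectrum H = [set nu1%:C], nu1 < 0
        & simple_even H nu1%:C]) /\
    (1 < `|d| -> exists nu1 : R,
      [/\ discrete_spectrum H = [set nu1%:C; k%:C], nu1 < 0,
          simple_even H nu1%:C & simple_odd H k%:C])).
Proof.
move=> H d s k p lower upper lam_gt0 aN1.
have b0 := alpha1_sqr_gt0 aN1.
set b := (_ + 1) ^+ 2 in b0.
(* c1 is c2 at (- d, - s), so c2 governs the even energies below 0 and c1 those above 4 lam. *)
have c1E : c1 (alpha lam lam1) d s = (- d + 1) * (- s + 1) - b.
  by rewrite /c1 -/b; ring.
have c2E : c2 (alpha lam lam1) d s = (d + 1) * (s + 1) - b by [].
have spectrum_lists lo hi : (forall y, branch d s b y <-> y \in lo) ->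
    (forall y, branch (- d) (- s) b y <-> y \in hi) -> discrete_spectrum H = _ :=
  @discrete_spectrum_branches R lam lam1 mu mu1 lam_gt0 aN1 lo hi.
have even_lo y : branch d s b y -> simple_even H (energy lam y)%:C :=
  @simple_even_lo R lam lam1 mu mu1 lam_gt0 aN1 y.
have even_hi y : branch (- d) (- s) b y -> simple_even H (energy lam (- y))%:C :=
  @simple_even_hi R lam lam1 mu mu1 lam_gt0 aN1 y.
have odd_k : 1 < `|d| -> simple_odd H k%:C :=
  @simple_odd_kappa R lam lam1 mu mu1 lam_gt0 aN1.
have none_lo : 0 <= c2 (alpha lam lam1) d s -> -1 <= d ->
    forall y, branch d s b y <-> y \in [::].
  move=> c2p d1 y; split=> // br; case: (no_branch b0 _ _ br); lra.
have none_hi : 0 <= c1 (alpha lam lam1) d s -> d <= 1 ->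
    forall y, branch (- d) (- s) b y <-> y \in [::].
  move=> c1p d1 y; split=> // br; case: (no_branch b0 _ _ br); lra.
have one_lo : c2 (alpha lam lam1) d s < 0 \/ c2 (alpha lam lam1) d s = 0 /\ d < -1 ->
    exists2 t, 1 < t & forall y, branch d s b y <-> y \in [:: t].
  move=> h; have [||t [[t1 _ _ _] tE]] := @one_branch _ d s b b0.
  - by case: h; lra.
  - by case: h => [?|[_ ?]]; [left; lra|right].
  by exists t => // y; rewrite mem_seq1 tE; split=> /eqP.
have one_hi : c1 (alpha lam lam1) d s < 0 \/ c1 (alpha lam lam1) d s = 0 /\ 1 < d ->
    exists2 t, 1 < t & forall y, branch (- d) (- s) b y <-> y \in [:: t].
  move=> h; have [||t [[t1 _ _ _] tE]] := @one_branch _ (- d) (- s) b b0.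
  - by case: h; lra.
  - by case: h => [?|[_ ?]]; [left; lra|right; lra].
  by exists t => // y; rewrite mem_seq1 tE; split=> /eqP.
have bound_min x : x < s -> x < (d ^+ 2 + 1) / (2 * d) ->
    2 * lam * (x + 1) < lower.
  by move=> xs xd; rewrite /lower ltr_pM2l ?mulr_gt0// ltrD2r lt_min xs xd.
have bound_max x : s < x -> (d ^+ 2 + 1) / (2 * d) < x ->
    upper < 2 * lam * (x + 1).
  by move=> xs xd; rewrite /upper ltr_pM2l ?mulr_gt0// ltrD2r gt_max xs xd.
have lower_upper : lower <= upper.
  by rewrite /lower /upper ler_pM2l ?mulr_gt0// lerD2r ge_min !le_max lexx.
split; [|split; [|split; [|split; [|split]]]].
- move=> [c1p c2p d1 s1].
  have [||t [u [nt pu tuE]]] := @two_branches _ (- d) (- s) b b0; try lra.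
  have hiP y : branch (- d) (- s) b y <-> y \in [:: t; u].
    rewrite !inE tuE; split=> [[->|->]|/orP[]/eqP ->]; rewrite ?eqxx ?orbT//.
      by left.
    by right.
  have loP := none_lo (ltW c2p) ltac:(lra).
  have d_norm : 1 < `|d| by rewrite ltr_normr d1.
  (* The root [t] with negative factors has t < d and t + 1/t < 2 s; for [u] both inequalities
     reverse. Since y + 1/y increases, these give the two bounds once d + 1/d is written in terms of
     the stated quotient. *)
  have wE : d + d^-1 = 2 * ((d ^+ 2 + 1) / (2 * d)).
    by field; rewrite gt_eqF//; lra.
  have eE y : energy lam (- y) = 2 * lam * ((y + y^-1) / 2 + 1).
    by rewrite /energy ?invrN; move: (y^-1) => v; field.
  have [t1 dt st _] := nt; have [u1 du su _] := pu.
  have td := ltr_addV (ltW t1) (_ : t < d).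
  have ud := ltr_addV (ltW d1) (_ : d < u).
  exists (energy lam (- t)), (energy lam (- u)); split.
  + by rewrite (spectrum_lists _ _ loP hiP) d_norm /= set_seq3.
  + by split; exact: energyN_gt.
  + split=> //; rewrite eE.
    * by apply: bound_min; [lra|have := td ltac:(lra); lra].
    * by apply: bound_max; [lra|have := ud ltac:(lra); lra].
  + by split; apply: even_hi; apply/tuE; [left|right].
  + exact: odd_k.
- move=> [c1p c2p dn sn]; move: (dn); rewrite ler_norml => /andP[dN1 d1].
  rewrite (spectrum_lists _ _ (none_lo c2p dN1) (none_hi c1p d1)) ltNge dn /=.
  by apply/seteqP; split.
- move=> [c1p c2p d1 s1].
  have [||t [u [nt pu tuE]]] := @two_branches _ d s b b0; try lra.
  have loP y : branch d s b y <-> y \in [:: u; t].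
    rewrite !inE tuE; split=> [[->|->]|/orP[]/eqP ->]; rewrite ?eqxx ?orbT//.
      by right.
    by left.
  have hiP := none_hi (ltW c1p) ltac:(lra).
  have d_norm : 1 < `|d| by rewrite ltr_normr; apply/orP; right; lra.
  have wE : - d + (- d)^-1 = - 2 * ((d ^+ 2 + 1) / (2 * d)).
    by rewrite invrN; field; rewrite lt_eqF//; lra.
  have eE y : energy lam y = 2 * lam * (- ((y + y^-1) / 2) + 1).
    by rewrite /energy; move: (y^-1) => v; field.
  have [t1 dt st _] := nt; have [u1 du su _] := pu.
  have td := ltr_addV (ltW t1) (_ : t < - d).
  have ud := ltr_addV (_ : 1 <= - d) (_ : - d < u).
  (* [energy] decreases on y > 1 and t < - d < u, so here the positive branch gives the lower
     eigenvalue. *)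
  exists (energy lam u), (energy lam t); split.
  + by rewrite (spectrum_lists _ _ loP hiP) d_norm /= set_seq3.
  + by split; exact: energy_lt0.
  + split=> //; rewrite eE.
    * by apply: bound_min; [lra|have := ud ltac:(lra) ltac:(lra); lra].
    * by apply: bound_max; [lra|have := td ltac:(lra); lra].
  + by split; apply: even_lo; apply/tuE; [right|left].
  + exact: odd_k.
- move=> Unp.
  (* Both pieces of the region yield the same data: no branch point for (d, s) and exactly one for
     (- d, - s). *)
  have [c2p dN1 c1n] : [/\ 0 <= c2 (alpha lam lam1) d s, -1 <= d &
      c1 (alpha lam lam1) d s < 0 \/ c1 (alpha lam lam1) d s = 0 /\ 1 < d].
    case: Unp => [[c1n c2p]|[c1z c2p d1 s1]]; last by split; [lra|lra|right].
    split=> //; last by left.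
    (* If d < -1, then c2 >= 0 forces s < -1, and c1 - c2 = - 2 (d + s) > 0 contradicts c1 < 0. *)
    rewrite leNgt; apply/negP => dlt.
    have : s < -1 by nra.
    by move: c1n c2p; rewrite c1E c2E; lra.
  have loP := none_lo c2p dN1; have [t t1 hiP] := one_hi c1n.
  have spec := spectrum_lists _ _ loP hiP.
  have tE : branch (- d) (- s) b t by apply/hiP; rewrite mem_head.
  split=> d1; exists (energy lam (- t)).
  + by rewrite spec ltNge d1 /= set_seq1; split; [|exact: energyN_gt|exact: even_hi].
  + by rewrite spec d1 /= set_seq2; split; [|exact: energyN_gt|exact: even_hi|exact: odd_k].
- move=> [c1n c2n].
  have [t t1 loP] := one_lo (or_introl c2n); have [u u1 hiP] := one_hi (or_introl c1n).
  have spec := spectrum_lists _ _ loP hiP.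
  have tE : branch d s b t by apply/loP; rewrite mem_head.
  have uE : branch (- d) (- s) b u by apply/hiP; rewrite mem_head.
  split=> d1; exists (energy lam t), (energy lam (- u)).
  + rewrite spec ltNge d1 /= set_seq2.
    by split; [|exact: energy_lt0|exact: energyN_gt|exact: even_lo|exact: even_hi].
  + rewrite spec d1 /= set_seq3.
    split=> //; first by split; [exact: energy_lt0|exact: energyN_gt].
    * exact: even_lo.
    * exact: even_hi.
    * exact: odd_k.
- move=> Upn.
  have [c1p d1' c2n] : [/\ 0 <= c1 (alpha lam lam1) d s, d <= 1 &
      c2 (alpha lam lam1) d s < 0 \/ c2 (alpha lam lam1) d s = 0 /\ d < -1].
    case: Upn => [[c1p c2n]|[c1p c2z d1 s1]]; last by split; [lra|lra|right].
    split=> //; last by left.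
    (* If d > 1, then c1 >= 0 forces s > 1, and c2 - c1 = 2 (d + s) > 0 contradicts c2 < 0. *)
    rewrite leNgt; apply/negP => dlt.
    have : 1 < s by nra.
    by move: c1p c2n; rewrite c1E c2E; lra.
  have hiP := none_hi c1p d1'; have [t t1 loP] := one_lo c2n.
  have spec := spectrum_lists _ _ loP hiP.
  have tE : branch d s b t by apply/loP; rewrite mem_head.
  split=> d1; exists (energy lam t).
  + by rewrite spec ltNge d1 /= set_seq1; split; [|exact: energy_lt0|exact: even_lo].
  + by rewrite spec d1 /= set_seq2; split; [|exact: energy_lt0|exact: even_lo|exact: odd_k].
Qed.
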